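(* Let $B\in\mathcal L(U,H)$, $E\in\mathcal L(H,Y)$, $Q=E^*E$, $S=BB^*$, $P_0\in\Sigma^+(H)$, and let $A:\mathcal D(A)\subset H\to H$ be the generator of an analytic semigroup on $H$. Assume in addition that $S$ and $AS$ both belong to $\mathcal L(H)$. Let $P$ be the solution on $[0,T]$ of $$\dot P=\mathcal A P+Q-PSP,\qquad P(0)=P_0,$$ and let $\mathcal L_\tau=\mathrm e^{\tau F}\mathrm e^{\tau G}$ be the Lie splitting operator. Then there exist constants $D,\tau^*>0$, depending only on $\|P\|_\infty$, $T$, $\|S\|_{\mathcal L(H)}$, $\|Q\|_{\mathcal L(H)}$, $\|AS\|_{\mathcal L(H)}$ (and on the fixed operator $A$ through the semigroup constant $C_A$ of the context), such that for every step size $\tau=T/N$, $N\in\mathbb N$, with $\tau\le\tau^*$ and every $n\in\{0,\dots,N\}$, $$\|P(n\tau)-\mathcal L_\tau^nP_0\|_{\mathcal L(H)}\le D\,\tau.$$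
   Context: $H$ is a complex Hilbert space, $U,Y$ are Hilbert spaces, $T>0$. $\mathcal L(X,Y)$ is the space of bounded linear operators, $\mathcal L(H)=\mathcal L(H,H)$. $\Sigma(H)=\{P\in\mathcal L(H): P=P^*\}$ with the $\mathcal L(H)$-norm and $\Sigma^+(H)=\{P\in\Sigma(H):P\ge0\}$. ''$AS\in\mathcal L(H)$'' means that $S$ maps $H$ into $\mathcal D(A)$ and $AS$ is bounded on $H$. Operator $\mathcal A$: for $P\in\Sigma(H)$ put $\varphi_P(x,y)=(Px,Ay)+(Ax,Py)$, $x,y\in\mathcal D(A)$. $\mathcal D(\mathcal A)$ is the set of $P\in\Sigma(H)$ for which $\varphi_P$ is continuous with respect to the norm of $H\times H$ (i.e. $|\varphi_P(x,y)|\le C\|x\|\|y\|$ for $x,y\in\mathcal D(A)$), and $\mathcal A(P)\in\Sigma(H)$ is the operator with $(\mathcal A(P)x,y)=\varphi_P(x,y)$ for $x,y\in\mathcal D(A)$. The associated semigroup on $\Sigma(H)$ is $\mathrm e^{t\mathcal A}P=\mathrm e^{tA^*}P\mathrm e^{tA}$, $t\ge0$. Function space: $C_p([0,T],\Sigma(H))$ is the set of $t\mapsto P(t)\in\Sigma(H)$ such that $t\mapsto P(t)x$ is continuous on $[0,T]$ for every $x\in H$, with norm $\|P\|_\infty=\sup_{t\in(0,T)}\|P(t)\|_{\mathcal L(H)}$ (finite). Solution: the solution $P$ of the equation is the unique $P\in C_p([0,T],\Sigma(H))$ with $P(0)=P_0$ such that for $t\in(0,T)$ $P$ is differentiable in $\mathcal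 L(H)$, $P(t)\in\mathcal D(\mathcal A)\cap\Sigma^+(H)$ and the equation holds. It is known to exist, to satisfy $P(t)\in\Sigma^+(H)$ for $t\in[0,T]$, and to be infinitely differentiable in $\mathcal L(H)$ with bounded derivatives on $[\varepsilon,T]$ for every $\varepsilon>0$. Splitting: $FP=\mathcal AP+Q$ and $GP=-PSP$. For $P_1\in\Sigma^+(H)$, $\mathrm e^{tF}P_1=\mathrm e^{t\mathcal A}P_1+\int_0^t\mathrm e^{(t-s)\mathcal A}Q\,\mathrm ds$ (integral in the pointwise sense on $H$) is the solution at time $t$ of $\dot P=FP$, $P(0)=P_1$, and $\mathrm e^{tG}P_1$ is the solution at time $t$ of $\dot P=GP$, $P(0)=P_1$. These flows map $\Sigma^+(H)$ to itself. $C_A$ denotes a constant with $\|\mathrm e^{tA}\|_{\mathcal L(H)}\le C_A$ and $\|A\mathrm e^{tA}\|_{\mathcal L(H)}\le C_A/t$ for $t\in(0,T]$. *)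

(* Defs.v *)
From HB Require Import structures.
From mathcomp Require Import all_boot all_order all_algebra.
From mathcomp Require Import sesquilinear complex.
From mathcomp Require Import all_classical all_reals all_analysis.

Set Implicit Arguments.
Unset Strict Implicit.
Unset Printing Implicit Defensive.

Import Order.TTheory GRing.Theory Num.Theory.
Import numFieldNormedType.Exports.

#[global] Open Scope classical_set_scope.
#[global] Open Scope ring_scope.
#[global] Open Scope complex_scope.

(* The inner product is linear in its first argument and conjugate-linear in
   its second one, and it induces the (complete) norm. *)
HB.mixin Record isHilbert (R : realType) H of @CompleteNormedModule R[i] H := {
  ip : {dot H for @Num.conj R[i]} ;
  sqr_normE : forall x : H, `|x| ^+ 2 = ip x x
}.

#[short(type="hilbertType")]
HB.structure Definition Hilbert (R : realType) :=
  {H of isHilbert R H & @CompleteNormedModule R[i] H}.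

Section BoundedOperators.
Context {R : realType}.
Implicit Types X Y H : hilbertType R.

(* The norms of X and Y take their values in R[i]; [nrm] is the same norm
   seen in R. *)
Definition nrm {X} (x : X) : R := complex.Re `|x|.

Definition bounded_op {X Y} (f : X -> Y) : Prop :=
  linear f /\ exists C : R, forall x, nrm (f x) <= C * nrm x.

(* Meaningful for f with [bounded_op f] only: [sup] is 0 on unbounded sets. *)
Definition opnorm {X Y} (f : X -> Y) : R :=
  sup [set nrm (f x) | x in [set x | nrm x <= 1]].

Definition adjoint {X Y} (f : X -> Y) (y : Y) : X :=
  get [set z | forall x, ip (f x) y = ip x z].

Definition selfadjoint_op {H} (P : H -> H) : Prop :=
  bounded_op P /\ P = adjoint P.

Definition nonneg_op {H} (P : H -> H) : Prop :=
  selfadjoint_op P /\ forall x, 0 <= ip (P x) x.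

(* Differentiability in the norm of bounded operators, at t and relatively to
   the set D of times (one-sided when t is an end point of D). *)
Definition op_derivative {H} (D : set R) (P : R -> H -> H) (t : R)
    (P' : H -> H) : Prop :=
  bounded_op P' /\
  opnorm (fun x => ((s - t)^-1)%:C *: (P s x - P t x) - P' x)
    @[s --> within D t^'] --> (0 : R).

Definition is_Riemann_integral {H} (f : R -> H) (a b : R) (v : H) : Prop :=
  forall e : R, 0 < e -> exists2 d : R, 0 < d &
    forall (n : nat) (s xi : nat -> R), s 0%N = a -> s n = b ->
      (forall k, (k < n)%N ->
         [/\ s k <= xi k, xi k <= s k.+1 & s k.+1 - s k < d]) ->
      nrm (\sum_(k < n) (s k.+1 - s k)%:C *: f (xi k) - v) < e.

Definition Riemann_integral {H} (f : R -> H) (a b : R) : H :=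
  get (is_Riemann_integral f a b).

End BoundedOperators.

(* An operator A : D(A) -> H with D(A) a subset of H; the values of [ufun]
   outside [dom] are irrelevant. *)
Record unbounded_op (R : realType) (H : hilbertType R) :=
  UnboundedOp { dom : set H ; ufun :> H -> H }.

Section Semigroups.
Context {R : realType} {H : hilbertType R}.
Implicit Types (A : unbounded_op H) (eA : R -> H -> H).

Definition C0_semigroup eA : Prop :=
  [/\ forall t, 0 <= t -> bounded_op (eA t),
      eA 0 = id,
      forall s t, 0 <= s -> 0 <= t -> eA (s + t) = eA s \o eA t
    & forall x, eA t x @[t --> 0^'+] --> x].

Definition is_generator A eA : Prop :=
  forall x, let q := fun t : R => (t^-1)%:C *: (eA t x - x) in
    (dom A x <-> cvg (q t @[t --> 0^'+])) /\
    (dom A x -> q t @[t --> 0^'+] --> A x).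

Definition sector (delta : R) : set R[i] :=
  [set z | exists r theta : R, [/\ 0 < r, `|theta| < delta
     & z = (r * cos theta) +i* (r * sin theta)]].

(* W is the extension of eA to a sector around the positive half-line; it is
   complex differentiable there in the norm of bounded operators. *)
Definition analytic_semigroup eA : Prop :=
  C0_semigroup eA /\
  exists (delta : R) (W : R[i] -> H -> H),
    0 < delta <= pi / 2 /\
    [/\ forall t, 0 <= t -> W t%:C = eA t,
        forall z, sector delta z -> bounded_op (W z),
        forall z, sector delta z -> exists2 W' : H -> H, bounded_op W' &
          opnorm (fun x => h^-1 *: (W (z + h) x - W z x) - W' x)
            @[h --> (0 : R[i]^o)^'] --> (0 : R),
        forall z w, sector delta z -> sector delta w ->
          W (z + w) = W z \o W w
      & forall x, W z x @[z --> within (sector delta) (nbhs (0 : R[i]^o))]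
          --> x].

Definition semigroup_constant (T : R) A eA (CA : R) : Prop :=
  forall t, 0 < t <= T ->
    opnorm (eA t) <= CA /\ opnorm (A \o eA t) <= CA / t.

End Semigroups.

Section Riccati.
Context {R : realType} {H : hilbertType R}.
Implicit Types (A : unbounded_op H) (eA : R -> H -> H) (P Q S X : H -> H).

Definition phi A P (x y : H) : R[i] := ip (P x) (A y) + ip (A x) (P y).

Definition dom_calA A P : Prop :=
  selfadjoint_op P /\ exists C : R, forall x y, dom A x -> dom A y ->
    complex.Re `|phi A P x y| <= C * nrm x * nrm y.

(* [calA A P X] is the relation X = calA(P); X is unique when D(A) is dense. *)
Definition calA A P X : Prop :=
  [/\ dom_calA A P, selfadjoint_op X
    & forall x y, dom A x -> dom A y -> ip (X x) y = phi A P x y].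

Definition sup_norm (T : R) (P : R -> H -> H) : R :=
  sup [set opnorm (P t) | t in `]0, T[%classic].

Definition Cp (T : R) (P : R -> H -> H) : Prop :=
  [/\ forall t, 0 <= t <= T -> selfadjoint_op (P t),
      forall x, {within `[0, T]%classic, continuous (fun t => P t x)}
    & has_ubound [set opnorm (P t) | t in `]0, T[%classic]].

Definition Riccati_solution (T : R) A Q S (P0 : H -> H) (P : R -> H -> H) :
    Prop :=
  [/\ Cp T P, P 0 = P0 &
    forall t, 0 < t < T ->
      [/\ dom_calA A (P t), nonneg_op (P t) &
        exists2 X, calA A (P t) X &
          op_derivative `]0, T[%classic P t
            (fun x => X x + Q x - P t (S (P t x)))]].

(* In a Hilbert space e^{tA*}, the semigroup generated by A*, is the adjoint
   of e^{tA}. *)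
Definition expcalA eA (t : R) P : H -> H := adjoint (eA t) \o P \o eA t.

(* The solution of P' = calA(P) + Q, P(0) = P1 (variation of constants), the
   integral being taken pointwise on H. *)
Definition expF eA Q (t : R) P1 : H -> H :=
  fun x => expcalA eA t P1 x
           + Riemann_integral (fun s => expcalA eA (t - s) Q x) 0 t.

Definition G_solution S P1 (Y : R -> H -> H) : Prop :=
  [/\ forall t, 0 <= t -> selfadjoint_op (Y t), Y 0 = P1 &
    forall t, 0 <= t ->
      op_derivative [set s | 0 <= s] Y t (fun x => - Y t (S (Y t x)))].

Definition expG S (t : R) P1 : H -> H :=
  get [set X | exists2 Y, G_solution S P1 Y & X = Y t].

Definition Lie eA Q S (tau : R) P1 : H -> H := expF eA Q tau (expG S tau P1).

End Riccati.

(* Main.v *)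
Require Import Defs.
From HB Require Import structures.
From mathcomp Require Import all_boot all_order all_algebra.
From mathcomp Require Import sesquilinear complex.
From mathcomp Require Import ring lra.
From mathcomp Require Import all_classical all_reals all_analysis.
Set Implicit Arguments.
Unset Strict Implicit.
Unset Printing Implicit Defensive.
Import Order.TTheory GRing.Theory Num.Theory.
Import numFieldNormedType.Exports.

(** Write [e^{tau F} X = e^{tau A*} X e^{tau A} + V_tau] and let [Y = e^{tau G} X].  Variation of
    constants along the exact solution gives
      [P(t+tau) = e^{tau A*} P(t) e^{tau A} + V_tau
                  - \int_0^tau e^{(tau-s)A*} (P S P)(t+s) e^{(tau-s)A} ds],
    while for [X = P(t)] one has [Y = X - tau X S X + O(tau^2)].  So one Lie step replaces the
    integrand [g(s)] by [g(0)], and its local error is [O(tau^2)] if [g] is Lipschitz.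

    The initial value is arbitrary, so [P'] may blow up like [1/t] at [t = 0] and it is not
    evident that [g] is Lipschitz with a uniform constant.  But [g] moves with the semigroup,
    and in
      [(P S P)' - (A* P S P + P S P A)
         = (A* P + P A) S P + P S (A* P + P A) - A* P S P - P S P A + bounded terms]
    the products with an unbounded outer factor cancel.  What remains is
    [P A S P + P (A S)^* P] and bounded terms, and [A S] is bounded: this is
    [commutator_defect].  The local error is thus [O(tau^2)] uniformly in [t], without the
    logarithm that a bound [tau^2 / t] would produce ([lie_local_error]).

    Stability: two steps of the quadratic flow differ by
    [(I - tau Y1 S) (X1 - X2) (I - tau S Y2)], that is by [X1 - X2] up to a relative change
    [O(tau)] ([riccati_resolvent_stability]).  Summing the local errors, each transported by one
    semigroup factor, a discrete Gronwall argument gives [O(tau)] in total.  The constants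
    depend on a bound of the iterates; for small [tau] this bound, [||P|| + 1], follows from
    the error estimate up to the preceding step ([lie_convergence]).

    All identities are written in weak form, for [Re <. x, y>].  Thus the unbounded [A] acts
    on vectors only, and derivatives are taken of scalar functions, to which the mean value
    theorem applies.  The semigroup [e^{tA}] maps into the domain of [A] for [t > 0], so the
    weak form holds for all [x] and [y].

    The remaining parts justify the definitions by choice of a value: a variational argument
    yields the Riesz theorem, hence adjoints, and the inverse of [I + t B^* X B], hence a global
    solution of [Y' = - Y S Y], which is unique by Gronwall ([expGP]); and the vector-valued
    Riemann integral exists ([convolution_Riemann]). *)

(** * The real inner product and operator norms *)

Section RealInner.
Context {R : realType}.
Implicit Types X Y H : hilbertType R.

(** All estimates are made with the real part of the inner product: it is a real inner
    product with the same norm, and a complex identity follows from two real ones. *)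
Definition rip {X} (x y : X) : R := complex.Re (ip x y).

Lemma ReD (a b : R[i]) : complex.Re (a + b) = complex.Re a + complex.Re b.
Proof. by case: a => a1 a2; case: b. Qed.

Lemma ReN (a : R[i]) : complex.Re (- a) = - complex.Re a.
Proof. by case: a => a1 a2. Qed.

Lemma Re_conj (a : R[i]) : complex.Re (Num.conj a) = complex.Re a.
Proof. by case: a => a1 a2. Qed.

Lemma ReZ (r : R) (a : R[i]) : complex.Re (r%:C * a) = r * complex.Re a.
Proof. by case: a => a1 a2 /=; rewrite mul0r subr0. Qed.

Lemma Re_iM (a : R[i]) : complex.Re ('i * a) = - complex.Im a.
Proof. by case: a => a1 a2; rewrite -complexiE /= mul0r mul1r sub0r. Qed.

Lemma Re_conj_iM (a : R[i]) : complex.Re (Num.conj 'i * a) = complex.Im a.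
Proof.
by case: a => a1 a2; rewrite -complexiE /Num.conj /= mul0r sub0r mulN1r opprK.
Qed.

Lemma complex_eta (a : R[i]) : a = (complex.Re a +i* complex.Im a)%C.
Proof. by case: a. Qed.

Lemma conj_real (r : R) : Num.conj r%:C = r%:C.
Proof. by rewrite /= /Num.conj /= oppr0. Qed.

Lemma ripDl {X} (x y z : X) : rip (x + y) z = rip x z + rip y z.
Proof. by rewrite /rip linearDl ReD. Qed.
Lemma ripDr {X} (x y z : X) : rip x (y + z) = rip x y + rip x z.
Proof. by rewrite /rip linearDr ReD. Qed.
Lemma ripNl {X} (x y : X) : rip (- x) y = - rip x y.
Proof. by rewrite /rip linearNl ReN. Qed.
Lemma ripNr {X} (x y : X) : rip x (- y) = - rip x y.
Proof. by rewrite /rip linearNr ReN. Qed.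
Lemma ripBl {X} (x y z : X) : rip (x - y) z = rip x z - rip y z.
Proof. by rewrite ripDl ripNl. Qed.
Lemma ripBr {X} (x y z : X) : rip x (y - z) = rip x y - rip x z.
Proof. by rewrite ripDr ripNr. Qed.
Lemma ripZl {X} (r : R) (x y : X) : rip (r%:C *: x) y = r * rip x y.
Proof. by rewrite /rip linearZl_LR ReZ. Qed.
Lemma ripZr {X} (r : R) (x y : X) : rip x (r%:C *: y) = r * rip x y.
Proof. by rewrite /rip linearZr_LR /= conj_real ReZ. Qed.
Lemma rip0l {X} (y : X) : rip 0 y = 0.
Proof. by rewrite /rip linear0l. Qed.
Lemma rip0r {X} (y : X) : rip y 0 = 0.
Proof. by rewrite /rip linear0r. Qed.
Lemma ipC {X} (x y : X) : ip x y = Num.conj (ip y x).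
Proof. by rewrite hermC expr0 mul1r. Qed.
Lemma ripC {X} (x y : X) : rip x y = rip y x.
Proof. by rewrite /rip ipC Re_conj. Qed.

Lemma rip_suml {X} n (g : 'I_n -> X) y :
  rip (\sum_(k < n) g k) y = \sum_(k < n) rip (g k) y.
Proof.
elim: n g => [|n IH] g; first by rewrite !big_ord0 rip0l.
by rewrite !big_ord_recr /= ripDl IH.
Qed.

(** The imaginary part of the inner product is the real part of a rotated one. *)
Lemma ip_rip {X} (x y : X) : ip x y = (rip x y +i* - rip ('i *: x) y)%C.
Proof.
apply: etrans (complex_eta _) _; congr (_ +i* _)%C.
by rewrite /rip linearZl_LR Re_iM opprK.
Qed.

Lemma rip_iC {X} (x y : X) : rip ('i *: x) y = - rip x ('i *: y).
Proof.
by rewrite /rip linearZl_LR linearZr_LR /= Re_iM Re_conj_iM.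
Qed.

Lemma nrm_ge0 {X} (x : X) : 0 <= nrm x.
Proof. by rewrite /nrm; have := normr_ge0 x; rewrite lecE => /andP[]. Qed.

Lemma normE {X} (x : X) : `|x| = (nrm x)%:C.
Proof.
rewrite /nrm; have := normr_ge0 x; case: (`|x|) => a b /=.
by rewrite lecE /= => /andP[/eqP -> _].
Qed.

Lemma nrm_sqr {X} (x : X) : nrm x ^+ 2 = rip x x.
Proof. by rewrite /rip -sqr_normE normE -rmorphXn. Qed.

Lemma nrm0 {X} : nrm (0 : X) = 0. Proof. by rewrite /nrm normr0. Qed.
Lemma nrm0_eq0 {X} (x : X) : nrm x = 0 -> x = 0.
Proof. by move=> h; apply/eqP; rewrite -normr_eq0 normE h. Qed.
Lemma nrmN {X} (x : X) : nrm (- x) = nrm x. Proof. by rewrite /nrm normrN. Qed.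
Lemma nrmB {X} (x y : X) : nrm (x - y) = nrm (y - x).
Proof. by rewrite -nrmN opprB. Qed.
Lemma nrmD {X} (x y : X) : nrm (x + y) <= nrm x + nrm y.
Proof.
have := ler_normD x y; rewrite !normE -rmorphD lecE => /andP[_ //].
Qed.
Lemma nrmZ {X} (r : R) (x : X) : nrm (r%:C *: x) = `|r| * nrm x.
Proof.
by rewrite /nrm normrZ normE normc_def /= expr0n /= addr0 sqrtr_sqr mul0r subr0.
Qed.

(** The polynomial [t |-> |x - t y|^2] is nonnegative at its minimum. *)
Lemma rip_CS {X} (x y : X) : `|rip x y| <= nrm x * nrm y.
Proof.
have [->|y0] := eqVneq y 0; first by rewrite rip0r nrm0 mulr0 normr0.
have ny : 0 < nrm y.
  rewrite lt_neqAle nrm_ge0 andbT; apply/eqP => /esym h.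
  by move/eqP: y0; apply; exact: nrm0_eq0.
rewrite -(ler_pXn2r (n := 2)) ?nnegrE ?mulr_ge0 ?nrm_ge0 //.
rewrite real_normK ?num_real // exprMn.
set t := rip x y / nrm y ^+ 2.
have : 0 <= rip (x - t%:C *: y) (x - t%:C *: y) by rewrite -nrm_sqr sqr_ge0.
rewrite ripBl !ripBr !ripZl !ripZr -!nrm_sqr (ripC y x) => h.
have h2 : t * nrm y ^+ 2 = rip x y by rewrite /t divfK // expf_neq0 // gt_eqF.
have : 0 <= (nrm x ^+ 2 - t * rip x y) * nrm y ^+ 2.
  by apply: mulr_ge0; rewrite ?sqr_ge0 //; nra.
rewrite mulrBl (mulrAC t) h2; lra.
Qed.

(** Riesz duality: operators that are only known through their quadratic or sesquilinear
    forms are estimated by testing against all vectors. *)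
Lemma nrm_le_rip {X} (x : X) (c : R) : 0 <= c ->
  (forall y, rip x y <= c * nrm y) -> nrm x <= c.
Proof.
move=> c0 h; have := h x; rewrite -nrm_sqr.
have [->//|x0] := eqVneq (nrm x) 0.
by rewrite expr2 ler_pM2r // lt_neqAle nrm_ge0 eq_sym x0.
Qed.

Lemma rip_ext {X} (x y : X) : (forall z, rip x z = rip y z) -> x = y.
Proof.
move=> h; apply/eqP; rewrite -subr_eq0; apply/eqP; apply: nrm0_eq0.
apply/eqP; rewrite -(@sqrf_eq0 R); apply/eqP.
by rewrite nrm_sqr ripBl h subrr.
Qed.

Lemma ip_eq_rip {X Y} (x y : X) (x' y' : Y) :
  rip x y = rip x' y' -> rip ('i *: x) y = rip ('i *: x') y' ->
  ip x y = ip x' y'.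
Proof. by rewrite [ip x y]ip_rip [ip x' y']ip_rip => -> ->. Qed.

Definition bounded_by {X Y} (f : X -> Y) (c : R) :=
  forall x, nrm (f x) <= c * nrm x.

Lemma bounded_op_has_sup {X Y} (f : X -> Y) : bounded_op f ->
  has_sup [set nrm (f x) | x in [set x | nrm x <= 1]].
Proof.
move=> [lf [C hC]]; split.
  by exists (nrm (f 0)); exists 0 => //=; rewrite nrm0.
exists `|C| => _ [x /= hx <-]; apply: le_trans (hC x) _.
apply: le_trans (ler_wpM2r (nrm_ge0 x) (ler_norm C)) _.
by rewrite ler_piMr.
Qed.

Lemma opZ {X Y} (f : X -> Y) : linear f -> forall (a : R[i]) x, f (a *: x) = a *: f x.
Proof.
move=> lf a x; have f0 : f 0 = 0.
  by have := lf (-1) 0 0; rewrite scaler0 add0r scaleN1r addNr.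
by have := lf a x 0; rewrite !addr0 f0 addr0.
Qed.
Lemma opD {X Y} (f : X -> Y) : linear f -> forall x y, f (x + y) = f x + f y.
Proof. by move=> lf x y; have := lf 1 x y; rewrite !scale1r. Qed.
Lemma op0 {X Y} (f : X -> Y) : linear f -> f 0 = 0.
Proof. by move=> lf; have := opZ lf 0 0; rewrite !scale0r. Qed.
Lemma opN {X Y} (f : X -> Y) : linear f -> forall x, f (- x) = - f x.
Proof. by move=> lf x; have := opZ lf (-1) x; rewrite !scaleN1r. Qed.
Lemma opB {X Y} (f : X -> Y) : linear f -> forall x y, f (x - y) = f x - f y.
Proof. by move=> lf x y; rewrite opD // opN. Qed.

Lemma opnorm_ge0 {X Y} (f : X -> Y) : bounded_op f -> 0 <= opnorm f.
Proof.
move=> hf; apply: le_trans (nrm_ge0 (f 0)) _.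
by apply: sup_upper_bound; [exact: bounded_op_has_sup|exists 0 => //=; rewrite nrm0].
Qed.

Lemma opnormP {X Y} (f : X -> Y) : bounded_op f -> bounded_by f (opnorm f).
Proof.
move=> hf x; have [x0|x0] := eqVneq (nrm x) 0.
  by rewrite (nrm0_eq0 x0) (op0 hf.1) !nrm0 mulr0.
have xp : 0 < nrm x by rewrite lt_neqAle nrm_ge0 eq_sym x0.
rewrite -ler_pdivrMr //.
have -> : nrm (f x) / nrm x = nrm (f ((nrm x)^-1%:C *: x)).
  by rewrite (opZ hf.1) nrmZ ger0_norm ?invr_ge0 ?nrm_ge0 // mulrC.
apply: sup_upper_bound; first exact: bounded_op_has_sup.
exists ((nrm x)^-1%:C *: x) => //=.
by rewrite nrmZ ger0_norm ?mulVf // invr_ge0 nrm_ge0.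
Qed.

Lemma opnorm_le {X Y} (f : X -> Y) (c : R) : 0 <= c -> bounded_by f c -> opnorm f <= c.
Proof.
move=> c0 h; apply: ge_sup.
  by exists (nrm (f 0)); exists 0 => //=; rewrite nrm0.
move=> _ [x /= hx <-]; apply: le_trans (h x) _.
by rewrite ler_piMr.
Qed.

Lemma opnorm_lipschitz {X} (f g : X -> X) (c : R) : 0 <= c -> bounded_op f -> bounded_op g ->
  (forall x, nrm (f x - g x) <= c * nrm x) -> `|opnorm f - opnorm g| <= c.
Proof.
move=> c0 bf bg h.
have aux (f1 g1 : X -> X) : bounded_op f1 -> bounded_op g1 ->
   (forall x, nrm (f1 x - g1 x) <= c * nrm x) -> opnorm f1 <= opnorm g1 + c.
  move=> b1 b2 h1; apply: opnorm_le; first by rewrite addr_ge0 ?opnorm_ge0.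
  move=> x; rewrite -[f1 x](subrK (g1 x)); apply: le_trans (nrmD _ _) _.
  by rewrite mulrDl addrC lerD //; exact: opnormP.
have h1 := aux f g bf bg h.
have h2 : opnorm g <= opnorm f + c by apply: aux => // x; rewrite nrmB.
by rewrite ler_norml; apply/andP; split; lra.
Qed.

End RealInner.

(** * Riesz representation, adjoints and coercive operators *)

Section Riesz.
Local Open Scope ring_scope.
Local Open Scope complex_scope.
Context {R : realType}.
Implicit Types X Y H U : hilbertType R.

(** The metric of a complex normed space has its radii in [R[i]]; the positive ones are real. *)
Lemma pos_complex (e : R[i]) : 0 < e -> e = (complex.Re e)%:C /\ 0 < complex.Re e.
Proof. by case: e => a b; rewrite ltcE /= => /andP[/eqP -> ->]. Qed.

Lemma nrm_complete {X} (u : nat -> X) :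
  (forall e : R, 0 < e -> exists N : nat, forall m n, (N <= m)%N -> (N <= n)%N ->
     nrm (u m - u n) < e) ->
  exists l : X, forall e : R, 0 < e -> exists N : nat, forall n, (N <= n)%N ->
     nrm (u n - l) < e.
Proof.
move=> hu; have cu : cauchy (u @ \oo).
  apply: cauchy_exP => e e0; have [-> er0] := pos_complex e0.
  have [N hN] := hu _ er0; exists (u N).
  exists N => // n hn; rewrite /= -ball_normE /= normE ltcR.
  exact: hN.
have hl : u n @[n --> \oo] --> lim (u @ \oo) by exact: cauchy_cvg cu.
move/cvgrPdist_lt: hl => cvu.
exists (lim (u @ \oo)) => e e0.
have [|N _ hN] := cvu e%:C; first by rewrite ltcR.
by exists N => n hn; have := hN n hn; rewrite /= normE ltcR nrmB.
Qed.

Section Variational.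
Context {H : hilbertType R} (a : H -> H -> R) (I : H -> R) (C K : R).
Hypotheses (aD : forall x y z, a (x + y) z = a x z + a y z)
  (aZ : forall (r : R) x y, a (r%:C *: x) y = r * a x y)
  (aC : forall x y, a x y = a y x)
  (a_coercive : forall x, nrm x ^+ 2 <= a x x)
  (a_bounded : forall x y, `|a x y| <= C * nrm x * nrm y)
  (ID : forall x y, I (x + y) = I x + I y)
  (IZ : forall (r : R) x, I (r%:C *: x) = r * I x)
  (I_bounded : forall x, `|I x| <= K * nrm x).

Let J x := a x x / 2 - I x.

Let aDr x y z : a x (y + z) = a x y + a x z.
Proof. by rewrite aC aD !(aC x). Qed.
Let aZr (r : R) x y : a x (r%:C *: y) = r * a x y.
Proof. by rewrite aC aZ aC. Qed.

Let J_expand x y (t : R) :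
  J (x + t%:C *: y) = J x + t * (a x y - I y) + t ^+ 2 * a y y / 2.
Proof. rewrite /J !aD !aDr !aZ !aZr ID IZ (aC y x); lra. Qed.

Let J_ge x : - (K ^+ 2 / 2) <= J x.
Proof.
have h1 := a_coercive x; have h2 := le_trans (ler_norm _) (I_bounded x).
have h3 := sqr_ge0 (nrm x - K); rewrite /J; nra.
Qed.

Let m := inf (range J).

Let hasinf : has_inf (range J).
Proof.
split; first by exists (J 0); exists 0.
by exists (- (K ^+ 2 / 2)) => _ [x _ <-]; exact: J_ge.
Qed.

Let m_le x : m <= J x.
Proof. by apply: ge_inf; [exact: hasinf.2|exists x]. Qed.

(** A minimising sequence of [J x = a x x / 2 - I x] is Cauchy by the parallelogram
    identity, and the first variation of [J] vanishes at its limit.  With [a] the inner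
    product this is the Riesz representation theorem, with [a x y = <M x, y>] it inverts
    [M]. *)
Lemma variational_solution : exists v, forall y, a v y = I y.
Proof.
have ax (n : nat) : exists x, J x < m + n.+1%:R^-1.
  have n0 : 0 < (n.+1%:R : R)^-1 by rewrite invr_gt0.
  by have [_ [x _ <-] hx] := inf_adherent n0 hasinf; exists x.
have [u hu] := choice ax.
have cau k n : nrm (u k - u n) ^+ 2 <= 4 * (k.+1%:R^-1 + n.+1%:R^-1).
  have := a_coercive (u k - u n).
  have := hu k; have := hu n; have := m_le (u k + (2^-1)%:C *: (u n - u k)).
  rewrite J_expand.
  have -> : u k - u n = (-1)%:C *: (u n - u k).
    by rewrite rmorphN1 scaleN1r opprB.
  rewrite aZ aZr.
  have -> : J (u n) = J (u k) + 1 * (a (u k) (u n - u k) - I (u n - u k))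
      + 1 ^+ 2 * a (u n - u k) (u n - u k) / 2.
    by rewrite -J_expand scale1r addrC subrK.
  by move: (k.+1%:R^-1) (n.+1%:R^-1) => e1 e2; lra.
have [|v hv] := nrm_complete (u := u).
  move=> e e0; have e8 : 0 < e ^+ 2 / 8 by rewrite divr_gt0 ?exprn_gt0.
  have [N _ hN] := near_infty_natSinv_lt (PosNum e8).
  exists N => k n hk hn; have := cau k n.
  have := hN _ hk; have := hN _ hn => /= h1 h2 h3.
  rewrite -(ltr_pXn2r (n := 2)) ?nnegrE ?nrm_ge0 ?(ltW e0) //.
  move: (k.+1%:R^-1) (n.+1%:R^-1) h1 h2 h3 => e1 e2 /= h1 h2 h3.
  by apply: le_lt_trans h3 _; lra.
exists v => y; apply/eqP; rewrite -subr_eq0 -normr_le0; apply/ler_addgt0Pl => e e0.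
rewrite addr0.
set b := a y y; have b0 : 0 <= b by apply: le_trans (a_coercive y); exact: sqr_ge0.
have C0 : 0 < 1 + `|C| * nrm y.
  by rewrite ltr_wpDr // mulr_ge0 ?nrm_ge0.
have b1 : 0 < 1 + b by lra.
have [N1 hN1] : exists N, forall n, (N <= n)%N -> nrm (u n - v) < e / 2 / (1 + `|C| * nrm y).
  by apply: hv; rewrite !divr_gt0.
have e2 : 0 < (e / 2) ^+ 2 / (2 * (1 + b)) by rewrite divr_gt0 ?exprn_gt0 ?divr_gt0 ?mulr_gt0.
have [N2 _ hN2] := near_infty_natSinv_lt (PosNum e2).
set n := maxn N1 N2; have := hN1 n (leq_maxl _ _).
have := hN2 n (leq_maxr _ _) => /= h2; rewrite ltr_pdivlMr // => h1.
have h3 : `|a v y - a (u n) y| <= e / 2.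
  have -> : a v y - a (u n) y = - a (u n - v) y.
    have -> : u n = (u n - v) + v by rewrite subrK.
    by rewrite aD subrK; lra.
  rewrite normrN; apply: le_trans (a_bounded _ _) _; apply: le_trans (ltW h1).
  rewrite mulrDr mulr1 mulrA (mulrC _ `|C|).
  apply: le_trans (_ : `|C| * nrm (u n - v) * nrm y <= _).
    by rewrite !ler_wpM2r ?nrm_ge0 // ler_norm.
  by rewrite lerDr nrm_ge0.
have h4 : `|a (u n) y - I y| <= e / 2.
  set d := a (u n) y - I y.
  have e20 : 0 <= e / 2 by rewrite divr_ge0 // ltW.
  rewrite -(ler_pXn2r (n := 2)) ?nnegrE // real_normK ?num_real //.
  (* near-optimal step for t |-> J (u n + t y); 1 + b avoids dividing by a y y = 0 *)
  have := m_le (u n + (- (d / (1 + b)))%:C *: y); rewrite J_expand -/d -/b.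
  have := hu n; set r := d / (1 + b).
  have rE : d = r * (1 + b) by rewrite /r divfK // gt_eqF.
  have r2 : n.+1%:R^-1 * (2 * (1 + b)) < (e / 2) ^+ 2 by rewrite -ltr_pdivlMr ?mulr_gt0.
  move: r2; set w := n.+1%:R^-1; rewrite rE => r2 hJ1 hJ2.
  have : r ^+ 2 * (1 + b) <= 2 * w by have := sqr_ge0 r; nra.
  nra.
have -> : a v y - I y = (a v y - a (u n) y) + (a (u n) y - I y) by lra.
apply: le_trans (ler_normD _ _) _; lra.
Qed.
End Variational.

Lemma riesz {X} (I : X -> R) (K : R) :
  (forall x y, I (x + y) = I x + I y) ->
  (forall (r : R) x, I (r%:C *: x) = r * I x) ->
  (forall x, `|I x| <= K * nrm x) -> exists v, forall y, rip v y = I y.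
Proof.
move=> ID IZ IK; apply: (@variational_solution X rip I 1 K) => //.
- exact: ripDl.
- exact: ripZl.
- exact: ripC.
- by move=> x; rewrite nrm_sqr.
- by move=> x y; rewrite mul1r; exact: rip_CS.
Qed.

(** The Riesz representative of the real functional [x |-> Re <f x, y>] also represents the
    complex one, because [f] commutes with the rotation by [i]. *)
Lemma adjointP {X Y} (f : X -> Y) : bounded_op f ->
  forall x y, ip (f x) y = ip x (adjoint f y).
Proof.
move=> hf x y.
suff : [set z | forall x, ip (f x) y = ip x z] !=set0.
  by move=> /getPex; exact.
have [|||z hz] := @riesz X (fun x => rip (f x) y) (opnorm f * nrm y).
- by move=> u v; rewrite (opD hf.1) ripDl.
- by move=> r v; rewrite (opZ hf.1) ripZl.
- move=> u; apply: le_trans (rip_CS _ _) _.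
  by rewrite mulrAC ler_wpM2r ?nrm_ge0 //; exact: opnormP.
exists z => u /=; apply: ip_eq_rip; rewrite ripC.
  by rewrite -[RHS]ripC hz ripC.
by rewrite -[RHS]ripC hz (opZ hf.1) ripC.
Qed.

Lemma rip_adjoint {X Y} (f : X -> Y) : bounded_op f ->
  forall x y, rip (f x) y = rip x (adjoint f y).
Proof. by move=> hf x y; rewrite /rip adjointP. Qed.

Lemma adjoint_bounded {X Y} (f : X -> Y) : bounded_op f -> bounded_op (adjoint f).
Proof.
move=> hf; split.
  move=> a x y; apply: rip_ext => z; rewrite ripC [RHS]ripC.
  by rewrite /rip -adjointP // !linearDr !linearZr_LR /= !adjointP.
exists (opnorm f) => y; apply: nrm_le_rip.
  by rewrite mulr_ge0 ?nrm_ge0 ?opnorm_ge0.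
move=> x; rewrite ripC -rip_adjoint //.
apply: le_trans (ler_norm _) _; apply: le_trans (rip_CS _ _) _.
by rewrite mulrAC ler_wpM2r ?nrm_ge0 //; exact: opnormP.
Qed.

(** Symmetry of the real form is enough, since a bounded operator commutes with [i]. *)
Lemma selfadjoint_opP {X} (P : X -> X) :
  selfadjoint_op P <-> bounded_op P /\ forall x y, rip (P x) y = rip x (P y).
Proof.
split=> [[hP eP]|[hP sP]].
  by split=> // x y; rewrite rip_adjoint // -eP.
split=> //; apply/funext => y; apply: rip_ext => x.
by rewrite ripC -sP rip_adjoint // ripC.
Qed.

(** [<P x, x>] is real when [P] is symmetric: rotating [x] by [i] changes the sign of its
    imaginary part and also leaves it unchanged. *)
Lemma nonneg_opP {X} (P : X -> X) :
  nonneg_op P <-> selfadjoint_op P /\ forall x, 0 <= rip (P x) x.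
Proof.
split=> [[hP nP]|[hP nP]]; split=> // x.
  by have := nP x; rewrite lecE => /andP[].
rewrite [ip _ _]ip_rip lecE /= nP andbT oppr_eq0.
have [bP sP] := (selfadjoint_opP P).1 hP.
have e1 : rip ('i *: P x) x = - rip ('i *: x) (P x) by rewrite rip_iC ripC.
have e2 : rip ('i *: P x) x = rip ('i *: x) (P x).
  by rewrite -sP (opZ bP.1).
lra.
Qed.

Lemma nonneg_bounded {X} (P : X -> X) : nonneg_op P -> bounded_op P.
Proof. by case=> -[]. Qed.

Lemma nonneg_sym {X} (P : X -> X) x y : nonneg_op P -> rip (P x) y = rip x (P y).
Proof. by case=> /selfadjoint_opP[]. Qed.

(** The Lax-Milgram theorem in the symmetric case. *)
Lemma coercive_inverse {U} (M : U -> U) : selfadjoint_op M ->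
  (forall x, nrm x ^+ 2 <= rip (M x) x) ->
  exists2 N : U -> U, selfadjoint_op N & forall x, M (N x) = x.
Proof.
move=> /selfadjoint_opP[bM sM] cM.
have ex x : exists v, M v = x.
  have [||||||||v hv] := @variational_solution U (fun x y => rip (M x) y)
      (fun y => rip x y) (opnorm M) (nrm x).
  - by move=> u v w; rewrite (opD bM.1) ripDl.
  - by move=> r u v; rewrite (opZ bM.1) ripZl.
  - by move=> u v; rewrite sM ripC.
  - exact: cM.
  - move=> u v; apply: le_trans (rip_CS _ _) _.
    by rewrite ler_wpM2r ?nrm_ge0 //; exact: opnormP.
  - by move=> u v; rewrite ripDr.
  - by move=> r u; rewrite ripZr.
  - by move=> u; exact: rip_CS.
  by exists v; apply: rip_ext.
have [N hN] := choice ex; exists N => //.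
have inj x y : M x = M y -> x = y.
  move=> e; apply/eqP; rewrite -subr_eq0; apply/eqP/nrm0_eq0.
  have := cM (x - y); rewrite (opB bM.1) e subrr rip0l => h.
  by apply/eqP; rewrite -(@sqrf_eq0 R) eq_le h sqr_ge0.
apply/selfadjoint_opP; split; last by move=> x y; rewrite -{2}(hN x) sM hN.
split; first by move=> a x y; apply: inj; rewrite bM.1 !hN.
exists 1 => x; rewrite mul1r.
have [->|n0] := eqVneq (nrm (N x)) 0; first exact: nrm_ge0.
have np : 0 < nrm (N x) by rewrite lt_neqAle nrm_ge0 eq_sym n0.
rewrite -(ler_pM2r np) -expr2; apply: le_trans (cM _) _; rewrite hN.
exact: le_trans (ler_norm _) (rip_CS _ _).
Qed.

(** For maps built from real Riesz representatives, whose complex homogeneity is not immediate. *)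
Lemma linear_of_real {X Y} (f : X -> Y) :
  (forall x y, f (x + y) = f x + f y) ->
  (forall (r : R) x, f (r%:C *: x) = r%:C *: f x) ->
  (forall x, f ('i *: x) = 'i *: f x) -> linear f.
Proof.
move=> fD fZ fi a x y; rewrite fD; congr (_ + _).
rewrite [a]complexE !scalerDl fD fZ -!scalerA; congr (_ + _).
by rewrite fi fZ.
Qed.

Lemma bounded_comp {X Y Z : hilbertType R} (f : X -> Y) (g : Y -> Z) :
  bounded_op f -> bounded_op g -> bounded_op (g \o f).
Proof.
move=> hf hg; split; first by move=> a x y /=; rewrite hf.1 hg.1.
exists (opnorm g * opnorm f) => x /=; apply: le_trans (opnormP hg _) _.
by rewrite -mulrA ler_wpM2l ?opnorm_ge0 //; exact: opnormP.
Qed.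

Lemma bounded_addop {X Y} (f g : X -> Y) :
  bounded_op f -> bounded_op g -> bounded_op (fun x => f x + g x).
Proof.
move=> hf hg; split.
  by move=> a x y /=; rewrite hf.1 hg.1 scalerDr addrACA.
exists (opnorm f + opnorm g) => x; apply: le_trans (nrmD _ _) _.
by rewrite mulrDl lerD //; exact: opnormP.
Qed.

Lemma bounded_scale {X Y} (r : R) (f : X -> Y) :
  bounded_op f -> bounded_op (fun x => r%:C *: f x).
Proof.
move=> hf; split.
  by move=> a x y /=; rewrite hf.1 scalerDr !scalerA mulrC.
exists (`|r| * opnorm f) => x; rewrite nrmZ -mulrA ler_wpM2l //; exact: opnormP.
Qed.

Lemma bounded_oppop {X Y} (f : X -> Y) :
  bounded_op f -> bounded_op (fun x => - f x).
Proof.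
move=> hf; split; first by move=> a x y; rewrite hf.1 opprD scalerN.
by exists (opnorm f) => x; rewrite nrmN; exact: opnormP.
Qed.

Lemma bounded_id {X} : bounded_op (fun x : X => x).
Proof. by split=> //; exists 1 => x; rewrite mul1r. Qed.

Lemma adjoint_comp_nonneg {X Y} (f : X -> Y) :
  bounded_op f -> nonneg_op (adjoint f \o f).
Proof.
move=> bf; have E x y : rip ((adjoint f \o f) x) y = rip (f x) (f y).
  by rewrite /= ripC -(rip_adjoint bf) ripC.
apply/nonneg_opP; split; last by move=> x; rewrite E -nrm_sqr sqr_ge0.
apply/selfadjoint_opP; split; first by apply: bounded_comp => //; exact: adjoint_bounded.
by move=> x y; rewrite E [RHS]ripC E ripC.
Qed.

End Riesz.

(** * Differentiable curves in a Hilbert space *)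

Section Curves.
Context {R : realType}.
Implicit Types X Y H U : hilbertType R.
Local Open Scope ring_scope.
Local Open Scope complex_scope.

(** The scalars of [X] are complex while the parameter is real, so the derivative of a curve
    is not an instance of the derivative of maps between normed modules over one field. *)
Definition curve_deriv {X} (u : R -> X) (t : R) (u' : X) :=
  forall e : R, 0 < e -> exists2 d : R, 0 < d &
    forall h, `|h| < d -> nrm (u (t + h) - u t - h%:C *: u') <= e * `|h|.

Definition curve_cont {X} (D : set R) (u : R -> X) (t : R) :=
  forall e : R, 0 < e -> exists2 d : R, 0 < d &
    forall s, D s -> `|s - t| < d -> nrm (u s - u t) < e.

Lemma is_derive_eps (f : R -> R) (t l : R) :
  (forall e : R, 0 < e -> exists2 d : R, 0 < d &
    forall h, `|h| < d -> `|f (t + h) - f t - h * l| <= e * `|h|) ->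
  is_derive t 1 f l.
Proof.
move=> hf.
have cv : h^-1 *: ((f \o shift t) (h *: (1 : R)) - f t) @[h --> (0:R)^'] --> l.
  apply/cvgrPdist_le => e e0; have [d d0 hd] := hf _ e0.
  rewrite /dnbhs near_withinE; apply/nbhs_ballP; exists d => //= h.
  rewrite /ball /= sub0r normrN => hh h0.
  rewrite -(ler_pM2r (_ : 0 < `|h|)) ?normr_gt0 // -normrM.
  have -> : (l - h^-1 *: (f (h *: 1 + t) - f t)) * h = - (f (t + h) - f t - h * l).
    rewrite /GRing.scale /= mulr1 (addrC h) mulrBl mulrAC mulVf // mul1r; ring.
  by rewrite normrN; exact: hd.
apply: DeriveDef; first by apply/cvg_ex; exists l.
exact: cvg_lim cv.
Qed.

Lemma within_continuous_eps (f : R -> R) (a b : R) :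
  (forall t, a <= t <= b -> forall e : R, 0 < e -> exists2 d : R, 0 < d &
    forall s, a <= s <= b -> `|s - t| < d -> `|f s - f t| < e) ->
  {within `[a, b], continuous f}.
Proof.
move=> hf; apply/subspace_continuousP => t /= tab.
apply/cvgrPdist_lt => e e0.
have [|d d0 hd] := hf t _ e e0; first by move: tab; rewrite in_itv.
rewrite near_withinE; apply/nbhs_ballP; exists d => //= s /=.
rewrite /ball /= => hs; rewrite in_itv /= => sab.
by rewrite distrC; apply: hd; rewrite // distrC.
Qed.

Lemma curve_deriv_cont {X} (u : R -> X) t u' (D : set R) :
  curve_deriv u t u' -> curve_cont D u t.
Proof.
move=> hu e e0; have [d d0 hd] := hu 1 ltr01.
have c0 : 0 < 1 + nrm u' by rewrite ltr_wpDr ?nrm_ge0.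
exists (Num.min d (e / (1 + nrm u'))); first by rewrite lt_min d0 divr_gt0.
move=> s _; rewrite lt_min => /andP[h1 h2].
have := hd (s - t) h1; rewrite (addrC t) subrK mul1r => h3.
have -> : u s - u t = (u s - u t - (s - t)%:C *: u') + (s - t)%:C *: u'.
  by rewrite subrK.
apply: le_lt_trans (nrmD _ _) _; rewrite nrmZ.
by move: h2; rewrite ltr_pdivlMr // => h2; lra.
Qed.

Lemma is_derive_rip {X} (u v : R -> X) t u' v' :
  curve_deriv u t u' -> curve_deriv v t v' ->
  is_derive t 1 (fun s => rip (u s) (v s)) (rip u' (v t) + rip (u t) v').
Proof.
move=> hu hv; apply: is_derive_eps => e e0.
have c0 : 0 < 1 + nrm (u t) + nrm (v t) by have := nrm_ge0 (u t); have := nrm_ge0 (v t); lra.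
have c1 : 0 < (nrm u' + 1) * (nrm v' + 1).
  by rewrite mulr_gt0 // ltr_wpDl ?nrm_ge0.
set k := Num.min 1 (e / 2 / (1 + nrm (u t) + nrm (v t))).
have k0 : 0 < k by rewrite lt_min ltr01 !divr_gt0.
have k1 : k <= 1 by rewrite ge_min lexx.
have k2 : k * (1 + nrm (u t) + nrm (v t)) <= e / 2.
  by rewrite -ler_pdivlMr // ge_min lexx orbT.
have [d1 d10 hd1] := hu _ k0; have [d2 d20 hd2] := hv _ k0.
exists (Num.min (Num.min d1 d2) (e / 2 / ((nrm u' + 1) * (nrm v' + 1)))).
  by rewrite !lt_min d10 d20 !divr_gt0.
move=> h; rewrite !lt_min => /andP[/andP[h1 h2]]; rewrite ltr_pdivlMr // => h3.
have {hd1 h1} := hd1 h h1; have {hd2 h2} := hd2 h h2.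
set al := u (t + h) - u t - _; set be := v (t + h) - v t - _ => hbe hal.
have du : u (t + h) - u t = al + h%:C *: u' by rewrite subrK.
have dv : v (t + h) - v t = be + h%:C *: v' by rewrite subrK.
have nu : nrm (u (t + h) - u t) <= (nrm u' + 1) * `|h|.
  rewrite du; apply: le_trans (nrmD _ _) _; rewrite nrmZ.
  have := normr_ge0 h; nra.
have nv : nrm (v (t + h) - v t) <= (nrm v' + 1) * `|h|.
  rewrite dv; apply: le_trans (nrmD _ _) _; rewrite nrmZ.
  have := normr_ge0 h; nra.
have -> : rip (u (t + h)) (v (t + h)) - rip (u t) (v t)
    - h * (rip u' (v t) + rip (u t) v')
  = rip al (v t) + rip (u t) be + rip (u (t + h) - u t) (v (t + h) - v t).
  rewrite /al /be !(ripBl, ripBr, ripZl, ripZr); ring.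
apply: le_trans (ler_normD _ _) _.
apply: le_trans (lerD (ler_normD _ _) (lexx _)) _.
have := rip_CS al (v t); have := rip_CS (u t) be.
have := rip_CS (u (t + h) - u t) (v (t + h) - v t).
have := nrm_ge0 (u t); have := nrm_ge0 (v t) => nv0 nu0 e1 e2 e3.
have e4 : nrm (u (t + h) - u t) * nrm (v (t + h) - v t)
   <= ((nrm u' + 1) * `|h|) * ((nrm v' + 1) * `|h|).
  by apply: ler_pM; rewrite ?nrm_ge0.
have e5 : nrm al * nrm (v t) <= (k * `|h|) * nrm (v t) by exact: ler_wpM2r.
have e6 : nrm (u t) * nrm be <= nrm (u t) * (k * `|h|) by exact: ler_wpM2l.
have e7 : (`|h| * ((nrm u' + 1) * (nrm v' + 1))) * `|h| <= e / 2 * `|h|.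
  by rewrite ler_wpM2r // ltW.
have e8 : k * (1 + nrm (u t) + nrm (v t)) * `|h| <= e / 2 * `|h|.
  by rewrite ler_wpM2r.
have e9 : 0 <= k * `|h| by rewrite mulr_ge0 // ltW.
have e10 : ((nrm u' + 1) * `|h|) * ((nrm v' + 1) * `|h|) =
  (`|h| * ((nrm u' + 1) * (nrm v' + 1))) * `|h| by ring.
nra.
Qed.

Lemma within_continuous_rip {X} (u v : R -> X) (a b : R) :
  (forall t, a <= t <= b -> curve_cont [set s | a <= s <= b] u t) ->
  (forall t, a <= t <= b -> curve_cont [set s | a <= s <= b] v t) ->
  {within `[a, b], continuous (fun s => rip (u s) (v s))}.
Proof.
move=> hu hv; apply: within_continuous_eps => t tab e e0.
have c0 : 0 < 1 + nrm (u t) + nrm (v t) by have := nrm_ge0 (u t); have := nrm_ge0 (v t); lra.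
set k := Num.min 1 (e / (1 + nrm (u t) + nrm (v t))).
have k0 : 0 < k by rewrite lt_min ltr01 !divr_gt0.
have k1 : k <= 1 by rewrite ge_min lexx.
have k2 : k * (1 + nrm (u t) + nrm (v t)) <= e.
  by rewrite -ler_pdivlMr // ge_min lexx orbT.
have [d1 d10 hd1] := hu t tab _ k0; have [d2 d20 hd2] := hv t tab _ k0.
exists (Num.min d1 d2); first by rewrite lt_min d10.
move=> s sab; rewrite lt_min => /andP[h1 h2].
have {hd1 h1} h1 := hd1 s sab h1; have {hd2 h2} h2 := hd2 s sab h2.
have -> : rip (u s) (v s) - rip (u t) (v t) = rip (u s - u t) (v s - v t)
   + rip (u s - u t) (v t) + rip (u t) (v s - v t).
  rewrite !(ripBl, ripBr); ring.
apply: le_lt_trans (ler_normD _ _) _.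
apply: le_lt_trans (lerD (ler_normD _ _) (lexx _)) _.
have := rip_CS (u s - u t) (v s - v t).
have := rip_CS (u s - u t) (v t); have := rip_CS (u t) (v s - v t).
have := nrm_ge0 (u t); have := nrm_ge0 (v t).
have := nrm_ge0 (u s - u t); have := nrm_ge0 (v s - v t).
move: (nrm (u s - u t)) (nrm (v s - v t)) (nrm (u t)) (nrm (v t)) h1 h2 k2 {c0} => x y p q.
move=> h1 h2 k2 y0 x0 q0 p0.
have : x * y < k by nra.
nra.
Qed.

Lemma curve_derivD {X} (u v : R -> X) t u' v' : curve_deriv u t u' ->
  curve_deriv v t v' -> curve_deriv (fun s => u s + v s) t (u' + v').
Proof.
move=> hu hv e e0; have e2 : 0 < e / 2 by rewrite divr_gt0.
have [d1 d10 h1] := hu _ e2; have [d2 d20 h2] := hv _ e2.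
exists (Num.min d1 d2) => [|h]; first by rewrite lt_min d10.
rewrite lt_min => /andP[/h1 k1 /h2 k2].
have -> : u (t + h) + v (t + h) - (u t + v t) - h%:C *: (u' + v') =
  (u (t + h) - u t - h%:C *: u') + (v (t + h) - v t - h%:C *: v').
  by rewrite scalerDr !opprD [X in X + _ = _]addrACA [LHS]addrACA.
apply: le_trans (nrmD _ _) _; lra.
Qed.

Lemma curve_deriv_comp {X Y} (f : X -> Y) (u : R -> X) t u' :
  bounded_op f -> curve_deriv u t u' -> curve_deriv (fun s => f (u s)) t (f u').
Proof.
move=> bf hu e e0; have o0 := opnorm_ge0 bf.
have e1 : 0 < e / (1 + opnorm f) by rewrite divr_gt0 //; lra.
have [d d0 hd] := hu _ e1; exists d => // h /hd hh.
rewrite -(opZ bf.1) -!(opB bf.1).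
apply: le_trans (opnormP bf _) _.
apply: le_trans (ler_wpM2l o0 hh) _.
rewrite mulrA ler_wpM2r // mulrA ler_pdivrMr; last lra.
by rewrite mulrC ler_wpM2l ?ltW // ltrDr.
Qed.

Lemma curve_cont_comp {X Y} (f : X -> Y) (u : R -> X) t D :
  bounded_op f -> curve_cont D u t -> curve_cont D (fun s => f (u s)) t.
Proof.
move=> bf hu e e0; have o0 := opnorm_ge0 bf.
have e1 : 0 < e / (1 + opnorm f) by rewrite divr_gt0 //; lra.
have [d d0 hd] := hu _ e1; exists d => // s Ds /(hd _ Ds).
rewrite ltr_pdivlMr => [h|]; last lra.
rewrite -(opB bf.1); apply: le_lt_trans (opnormP bf _) _.
by have := nrm_ge0 (u s - u t); lra.
Qed.

Lemma curve_derivN {X} (u : R -> X) t u' : curve_deriv u t u' ->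
  curve_deriv (fun s => - u s) t (- u').
Proof. by move=> hu; apply: (curve_deriv_comp (bounded_oppop bounded_id)). Qed.

Lemma curve_deriv_cst {X} (v : X) t : curve_deriv (fun=> v) t 0.
Proof.
move=> e e0; exists 1 => // h _.
by rewrite subrr scaler0 subrr nrm0 mulr_ge0 // ltW.
Qed.

Lemma curve_derivX {X} (u : R -> X) (t : R) u' : curve_deriv u t u' ->
  curve_deriv (fun s => s%:C *: u s) t (u t + t%:C *: u').
Proof.
move=> hu e e0; have e2 : 0 < e / 2 by rewrite divr_gt0.
have t1 : 0 < `|t| + 1 by rewrite ltr_wpDl.
have [d1 d10 h1] := hu _ (divr_gt0 e2 t1).
have [d2 d20 h2] := curve_deriv_cont setT hu e2.
exists (Num.min d1 d2) => [|h]; first by rewrite lt_min d10.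
rewrite lt_min => /andP[/h1 k1 k2].
have := h2 (t + h) I; have -> : t + h - t = h by rewrite addrC addKr.
move=> /(_ k2) {}k2.
have -> : (t + h)%:C *: u (t + h) - t%:C *: u t - h%:C *: (u t + t%:C *: u')
  = t%:C *: (u (t + h) - u t - h%:C *: u') + h%:C *: (u (t + h) - u t).
  apply: rip_ext => z; rewrite !(ripBl, ripDl, ripZl); ring.
apply: le_trans (nrmD _ _) _; rewrite !nrmZ.
have h3 : `|t| * nrm (u (t + h) - u t - h%:C *: u') <= e / 2 * `|h|.
  apply: le_trans (ler_wpM2l (normr_ge0 _) k1) _.
  rewrite mulrA ler_wpM2r // mulrCA ler_piMr ?(ltW e2) //.
  by rewrite ler_pdivrMr // mul1r lerDl.
have h4 : `|h| * nrm (u (t + h) - u t) <= `|h| * (e / 2) by rewrite ler_wpM2l // ltW.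
lra.
Qed.

(** Product rule for an operator path that is differentiable in operator norm, applied to a
    differentiable curve. *)
Lemma curve_deriv_app {X} (P : R -> X -> X) (P' : X -> X) (u : R -> X) t s u' :
  bounded_op (P (t + s)) -> bounded_op P' ->
  (forall e : R, 0 < e -> exists2 d : R, 0 < d & forall h x, `|h| < d ->
    nrm (P (t + s + h) x - P (t + s) x - h%:C *: P' x) <= e * `|h| * nrm x) ->
  curve_deriv u s u' ->
  curve_deriv (fun r => P (t + r) (u r)) s (P' (u s) + P (t + s) u').
Proof.
move=> bP bP' dP du e e0.
have c0 : 0 < nrm (u s) + 1 + opnorm (P (t + s)) + opnorm P'.
  by have := nrm_ge0 (u s); have := opnorm_ge0 bP; have := opnorm_ge0 bP'; lra.
pose k := Num.min 1 (e / (nrm (u s) + 1 + opnorm (P (t + s)) + opnorm P')).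
have k0 : 0 < k by rewrite lt_min ltr01 divr_gt0.
have k1 : k <= 1 by rewrite ge_min lexx.
have k2 : k * (nrm (u s) + 1 + opnorm (P (t + s)) + opnorm P') <= e.
  by rewrite -ler_pdivlMr // ge_min lexx orbT.
clearbody k.
have [d1 d10 h1] := dP _ k0; have [d2 d20 h2] := du _ k0.
have [d3 d30 h3] := curve_deriv_cont setT du k0.
exists (Num.min (Num.min d1 d2) d3) => [|h]; first by rewrite !lt_min d10 d20.
rewrite !lt_min => /andP[/andP[l1 l2] l3].
have := h3 (s + h) Logic.I; have -> : s + h - s = h by rewrite addrC addKr.
move=> /(_ l3) {}h3; have {}h2 := h2 h l2.
have {}h1 := h1 h (u (s + h)) l1.
rewrite addrA.
have -> : P (t + s + h) (u (s + h)) - P (t + s) (u s) - h%:C *: (P' (u s) + P (t + s) u')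
  = (P (t + s + h) (u (s + h)) - P (t + s) (u (s + h)) - h%:C *: P' (u (s + h)))
   + (P (t + s) (u (s + h) - u s - h%:C *: u') + h%:C *: P' (u (s + h) - u s)).
  rewrite !(opB bP.1) (opZ bP.1) (opB bP'.1).
  by apply: rip_ext => z; rewrite !(ripBl, ripDl, ripZl); ring.
apply: le_trans (nrmD _ _) _.
apply: le_trans (lerD (lexx _) (nrmD _ _)) _; rewrite nrmZ.
have q1 : nrm (u (s + h)) <= nrm (u s) + 1.
  rewrite -[u (s + h)](subrK (u s)); apply: le_trans (nrmD _ _) _; lra.
have hh := normr_ge0 h.
have q2 : k * `|h| * nrm (u (s + h)) <= k * `|h| * (nrm (u s) + 1).
  by apply: ler_wpM2l => //; rewrite mulr_ge0 // ltW.
have q3 : nrm (P (t + s) (u (s + h) - u s - h%:C *: u')) <= opnorm (P (t + s)) * (k * `|h|).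
  by apply: le_trans (opnormP bP _) _; apply: ler_wpM2l => //; exact: opnorm_ge0.
have q4 : nrm (P' (u (s + h) - u s)) <= opnorm P' * k.
  by apply: le_trans (opnormP bP' _) _; apply: ler_wpM2l; [exact: opnorm_ge0|exact: ltW].
have q5 := ler_wpM2l hh q4.
have q6 := ler_wpM2r hh k2.
lra.
Qed.

(** Gronwall: [exp (-2 L t) |w t|^2] is nonincreasing. *)
Lemma curve_eq0_of_deriv_le {X} (w w' : R -> X) (L T : R) : 0 < T ->
  (forall t, 0 < t < T -> curve_deriv w t (w' t)) ->
  (forall t, 0 < t < T -> nrm (w' t) <= L * nrm (w t)) ->
  (forall t, 0 <= t <= T -> curve_cont [set s | 0 <= s <= T] w t) ->
  w 0 = 0 -> w T = 0.
Proof.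
move=> T0 hd hL hc w0.
pose f s : R := rip (w s) (w s) * expR (- (2 * L) * s).
pose df s : R := (2 * rip (w' s) (w s) - 2 * L * rip (w s) (w s)) * expR (- (2 * L) * s).
have [||c cT] := @MVT R f df 0 T T0.
- move=> t; rewrite in_itv /= => /hd ht.
  have h1 := is_derive_rip ht ht.
  apply: is_derive_eq; rewrite /df /GRing.scale /= mulr1.
  rewrite (ripC (w t)); ring.
- have c1 : {within `[0, T], continuous (fun s => rip (w s) (w s))}.
    exact: within_continuous_rip.
  have c2 : {within `[0, T], continuous (fun s : R => expR (- (2 * L) * s))}.
    apply: continuous_subspaceT => x.
    apply: continuous_comp; last exact: continuous_expR.
    by apply: cvgM; [exact: cvg_cst|exact: cvg_id].
  by move=> x; rewrite /continuous_at /f; apply: cvgM; [exact: c1|exact: c2].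
rewrite subr0 /f w0 rip0l mul0r subr0 => hf.
have : f T <= 0.
  rewrite /f hf; apply: mulr_le0_ge0; last exact: ltW.
  rewrite /df; apply: mulr_le0_ge0; last exact: expR_ge0.
  have := hL c; move: cT; rewrite in_itv /= => cT /(_ cT) h.
  have := le_trans (ler_norm _) (rip_CS (w' c) (w c)).
  rewrite -nrm_sqr; have := nrm_ge0 (w c); nra.
rewrite /f pmulr_lle0 ?expR_gt0 // -nrm_sqr => h.
apply: nrm0_eq0; apply/eqP; rewrite -(@sqrf_eq0 R) eq_le h sqr_ge0 //.
Qed.

(** The integration starts at [a - 1], so that both end points are interior. *)
Lemma antiderivative_exists (f : R -> R) (a b : R) : a <= b -> continuous f ->
  exists F : R -> R, forall t, a <= t <= b -> is_derive t 1 F (f t).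
Proof.
move=> ab cf.
exists (fun x => \int[lebesgue_measure]_(t in `[(a - 1), x]) f t).
move=> t /andP[at_ tb].
have [||||dF eF] := @continuous_FTC1_closed R f (a - 1) t (b + 1).
- lra.
- apply: continuous_compact_integrable; first exact: segment_compact.
  by apply: continuous_subspaceT.
- lra.
- exact: cf.
by apply: DeriveDef; [exact: dF|rewrite -derive1E].
Qed.
End Curves.

(** * Analytic semigroups *)

Section Semigroup.
Context {R : realType} {H : hilbertType R}.
Local Open Scope ring_scope.
Local Open Scope complex_scope.
Variables (A : unbounded_op H) (eA : R -> H -> H).
Hypotheses (analytic : analytic_semigroup eA) (gen : is_generator A eA).

Lemma semigroup_bounded t : 0 <= t -> bounded_op (eA t).
Proof. by case: analytic => -[h _ _ _] _; exact: h. Qed.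

Lemma semigroup0 x : eA 0 x = x.
Proof. by case: analytic => -[_ -> _ _] _. Qed.

Lemma semigroupD s t x : 0 <= s -> 0 <= t -> eA (s + t) x = eA s (eA t x).
Proof. by case: analytic => -[_ _ h _] _ s0 t0; rewrite h. Qed.

Lemma semigroup_cont0 x (e : R) : 0 < e -> exists2 d : R, 0 < d &
  forall t, 0 <= t < d -> nrm (eA t x - x) < e.
Proof.
move=> e0; case: analytic => -[_ _ _ /(_ x) h] _.
move/cvgrPdist_lt: h => /(_ e%:C); rewrite ltcR => /(_ e0).
rewrite /at_right near_withinE => /nbhs_ballP[d /= d0 hd]; exists d => // t.
have [->|t0] := eqVneq t 0; first by rewrite semigroup0 subrr nrm0.
move=> /andP[t1 td]; have tp : 0 < t by rewrite lt_neqAle eq_sym t0.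
have := hd t; rewrite /ball /= sub0r normrN ger0_norm // => /(_ td tp).
by rewrite normE ltcR nrmB.
Qed.

(** The complex derivative in operator norm, restricted to real increments. *)
Lemma analytic_deriv t : 0 < t -> exists2 W' : H -> H, bounded_op W' &
  forall x, curve_deriv (fun s => eA s x) t (W' x).
Proof.
move=> t0; case: analytic => _ [delta [W [/andP[del0 _] [WA _ dW _ _]]]].
have [|W' bW' cW] := dW t%:C.
  by exists t, 0; rewrite normr0 cos0 sin0 mulr0 mulr1.
exists W' => // x e e0; have xe : 0 < 1 + nrm x by rewrite ltr_wpDr ?nrm_ge0.
have e1 : 0 < e / (1 + nrm x) by rewrite divr_gt0.
move/cvgrPdist_lt: cW => /(_ _ e1).
rewrite /dnbhs near_withinE => /nbhs_ballP[d /= d0 hd].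
have [dE dr0] := pos_complex d0.
exists (Num.min (complex.Re d) t); first by rewrite lt_min dr0.
move=> h; rewrite lt_min => /andP[h1 h2].
have [->|h0] := eqVneq h 0.
  by rewrite addr0 subrr sub0r scale0r oppr0 nrm0 normr0 mulr0.
have th0 : 0 <= t + h by have := ler_norm (- h); rewrite normrN; lra.
have /= := hd h%:C; rewrite /ball /= sub0r normrN normc_def /= expr0n /= addr0.
rewrite sqrtr_sqr dE ltcR => /(_ h1).
have -> : h%:C != 0 by rewrite (inj_eq (@complexI R)).
move=> /(_ isT); rewrite sub0r normrN => hop.
have opE : (fun x => (h%:C)^-1 *: (W (t%:C + h%:C) x - W t%:C x) - W' x)
  = (fun x => (h^-1)%:C *: (eA (t + h) x - eA t x) - W' x).
  apply/funext => y; rewrite -rmorphD !WA //; last exact: ltW.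
  by rewrite -fmorphV.
move: hop; rewrite opE => hop.
have bop : bounded_op (fun x => (h^-1)%:C *: (eA (t + h) x - eA t x) - W' x).
  apply: bounded_addop; last exact: bounded_oppop.
  apply: bounded_scale; apply: bounded_addop; first exact: semigroup_bounded.
  by apply: bounded_oppop; apply: semigroup_bounded; exact: ltW.
have -> : eA (t + h) x - eA t x - h%:C *: W' x
   = h%:C *: ((h^-1)%:C *: (eA (t + h) x - eA t x) - W' x).
  by rewrite scalerBr scalerA -rmorphM mulfV // scale1r.
rewrite nrmZ mulrC ler_wpM2r //.
apply: le_trans (opnormP bop x) _.
apply: le_trans (_ : e / (1 + nrm x) * (1 + nrm x) <= _); last by rewrite divfK // gt_eqF.
apply: ler_pM; rewrite ?opnorm_ge0 ?nrm_ge0 //; last by rewrite lerDr.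
by apply: ltW; apply: le_lt_trans hop; exact: ler_norm.
Qed.

(** Analyticity makes [h^-1 (e^{hA} - 1) e^{tA} x] converge, for every [x], to the value of a
    bounded operator; by definition of the generator this says that [e^{tA}] maps into
    the domain and that [A e^{tA}] is that operator. *)
Lemma generator_semigroup t : 0 < t -> bounded_op (A \o eA t) /\
  forall x, dom A (eA t x) /\ curve_deriv (fun s => eA s x) t (A (eA t x)).
Proof.
move=> t0; have [W' bW' dW] := analytic_deriv t0.
have key x : dom A (eA t x) /\ A (eA t x) = W' x.
  have cq : (h^-1)%:C *: (eA h (eA t x) - eA t x) @[h --> 0^'+] --> W' x.
    apply/cvgrPdist_le => e e0; have [-> er0] := pos_complex e0.
    have [d d0 hd] := dW x _ er0.
    rewrite /at_right near_withinE; apply/nbhs_ballP; exists d => //= h.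
    rewrite /ball /= sub0r normrN => hd1 h0; rewrite normE lecR nrmB.
    have := hd h hd1; rewrite (addrC t h) (semigroupD _ (ltW h0) (ltW t0)) => hle.
    rewrite -(ler_pM2r (_ : 0 < `|h|)); last by rewrite gtr0_norm.
    apply: le_trans hle; rewrite mulrC -nrmZ scalerBr scalerA -rmorphM.
    by rewrite mulfV ?scale1r // gt_eqF.
  have [[_ g1] g2] := gen (eA t x).
  have dm : dom A (eA t x) by apply: g1; apply/cvg_ex; exists (W' x).
  split=> //; have c2 := g2 dm.
  exact: (cvg_unique (@norm_hausdorff _ _) c2 cq).
split; last by move=> x; have [dx ->] := key x; split; [exact: dx|exact: dW].
suff -> : A \o eA t = W' by [].
by apply/funext => x /=; have [_ ->] := key x.
Qed.

Lemma semigroup_dom t x : 0 < t ->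
  dom A (eA t x) /\ curve_deriv (fun s => eA s x) t (A (eA t x)).
Proof. by move=> /generator_semigroup[_]; exact. Qed.

Lemma semigroup_A_bounded t : 0 < t -> bounded_op (A \o eA t).
Proof. by move=> /generator_semigroup[]. Qed.

Section Bounds.
Variables (T CA : R).
Hypotheses (T0 : 0 < T) (cst : semigroup_constant T A eA CA).

Lemma semigroup_constant_ge0 : 0 <= CA.
Proof.
have [|h _] := cst (t := T); first by rewrite T0 lexx.
by apply: le_trans h; apply: opnorm_ge0; apply: semigroup_bounded; exact: ltW.
Qed.

(** [1 + CA] also covers [t = 0], where the semigroup is the identity. *)
Lemma semigroup_norm t x : 0 <= t <= T -> nrm (eA t x) <= (1 + CA) * nrm x.
Proof.
have C0 := semigroup_constant_ge0; have x0 := nrm_ge0 x.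
have [->|tn0] := eqVneq t 0; first by rewrite semigroup0 => _; nra.
move=> /andP[t0 tT]; have tp : 0 < t by rewrite lt_neqAle eq_sym tn0.
have [|h _] := cst (t := t); first by rewrite tp.
apply: le_trans (opnormP (semigroup_bounded t0) x) _; nra.
Qed.

Lemma semigroup_A_norm t x : 0 < t <= T -> nrm (A (eA t x)) <= CA / t * nrm x.
Proof.
move=> /[dup] ht /andP[t0 _]; have [_ h] := cst ht.
by apply: le_trans (opnormP (semigroup_A_bounded t0) x) _; rewrite ler_wpM2r ?nrm_ge0.
Qed.
End Bounds.

Lemma semigroup_cont t x : 0 <= t -> curve_cont [set s | 0 <= s] (fun s => eA s x) t.
Proof.
have [->|tn0] := eqVneq t 0 => t0 e e0.
  have [d d0 hd] := semigroup_cont0 x e0; exists d => // s /= s0.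
  by rewrite subr0 ger0_norm // semigroup0 => sd; apply: hd; rewrite s0.
have tp : 0 < t by rewrite lt_neqAle eq_sym tn0.
exact: (curve_deriv_cont _ (semigroup_dom x tp).2).
Qed.

End Semigroup.

(** * Scalar integrals and Riemann integrals *)

Section Integral.
Context {R : realType}.
Local Open Scope ring_scope.
Local Open Scope complex_scope.

(** An integral is recorded by a primitive.  Continuity up to the end points is kept apart from
    differentiability inside, because the functions met below are differentiable only in
    the open interval. *)
Definition primitive_integral (a b : R) (f : R -> R) (c : R) :=
  exists F : R -> R, [/\ forall t, a < t < b -> is_derive t 1 F (f t),
    {within `[a, b], continuous F} & c = F b - F a].

(** The mean value theorem for the primitive. *)
Lemma primitive_integral_mean a b f c : a < b -> primitive_integral a b f c ->
  exists2 t, a < t < b & c = f t * (b - a).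
Proof.
move=> ab [F [dF cF ->]].
have dF2 t : t \in `]a, b[ -> is_derive t 1 F (f t).
  by rewrite in_itv; exact: dF.
have [t] := MVT ab dF2 cF; rewrite in_itv /= => tab ->; by exists t.
Qed.

Lemma primitive_integralD a b f g c d :
  primitive_integral a b f c -> primitive_integral a b g d ->
  primitive_integral a b (fun t => f t + g t) (c + d).
Proof.
move=> [F [dF cF ->]] [G [dG cG ->]]; exists (fun t => F t + G t); split.
- by move=> t tab; have := dF t tab; have := dG t tab => h1 h2; exact: is_deriveD.
- by move=> x; rewrite /continuous_at; apply: cvgD; [exact: cF|exact: cG].
- by rewrite opprD addrACA.
Qed.

Lemma primitive_integralZ a b f c (r : R) :
  primitive_integral a b f c -> primitive_integral a b (fun t => r * f t) (r * c).
Proof.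
move=> [F [dF cF ->]]; exists (fun t => r * F t); split.
- by move=> t tab; have := dF t tab => h1; exact: is_deriveZ.
- by move=> x; rewrite /continuous_at; apply: cvgM; [exact: cvg_cst|exact: cF].
- by rewrite mulrBr.
Qed.

Lemma primitive_integral_unique a b f g c d : a < b ->
  (forall t, a < t < b -> f t = g t) ->
  primitive_integral a b f c -> primitive_integral a b g d -> c = d.
Proof.
move=> ab fg hc /(primitive_integralZ (-1)) hd.
have [t tab] := primitive_integral_mean ab (primitive_integralD hc hd).
rewrite (fg t tab) => h; apply/eqP; rewrite -subr_eq0; apply/eqP.
by rewrite -mulN1r h mulN1r subrr mul0r.
Qed.

Lemma primitive_integral_exists a b f : a <= b -> continuous f ->
  exists c, primitive_integral a b f c.
Proof.
move=> ab cf; have [F dF] := antiderivative_exists ab cf.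
exists (F b - F a), F; split => //.
  by move=> t /andP[h1 h2]; apply: dF; rewrite !ltW.
apply: derivable_within_continuous => t; rewrite in_itv /= => /dF h.
exact: ex_derive.
Qed.

Lemma primitive_integral_sub (a b a' b' : R) (f F : R -> R) : a <= a' -> b' <= b ->
  (forall t, a < t < b -> is_derive t 1 F (f t)) ->
  {within `[a, b], continuous F} -> primitive_integral a' b' f (F b' - F a').
Proof.
move=> aa bb dF cF; exists F; split => //.
  by move=> t /andP[h1 h2]; apply: dF; rewrite (le_lt_trans aa h1) (lt_le_trans h2 bb).
apply: continuous_subspaceW cF => t /=; rewrite !in_itv /= => /andP[h1 h2].
by rewrite (le_trans aa h1) (le_trans h2 bb).
Qed.

(** Uniform subdivisions tagged at their left ends have arbitrarily small mesh. *)
Lemma Riemann_integral_unique {X : hilbertType R} (f : R -> X) (a b : R) v w :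
  a <= b -> is_Riemann_integral f a b v -> is_Riemann_integral f a b w -> v = w.
Proof.
move=> ab hv hw; apply/eqP; rewrite -subr_eq0; apply/eqP/nrm0_eq0/eqP.
rewrite eq_le nrm_ge0 andbT; apply/ler_addgt0Pl => e e0; rewrite addr0.
have e2 : 0 < e / 2 by rewrite divr_gt0.
have [d1 d10 h1] := hv _ e2; have [d2 d20 h2] := hw _ e2.
have m0 : 0 < Num.min d1 d2 by rewrite lt_min d10.
have m1 : 0 < Num.min d1 d2 / (b - a + 1) by rewrite divr_gt0 //; lra.
have [n _ hn] := near_infty_natSinv_lt (PosNum m1).
have {hn} /= hn := hn n (leqnn n).
pose s (k : nat) : R := a + (b - a) * k%:R / n.+1%:R.
have n0 : n.+1%:R != 0 :> R by rewrite pnatr_eq0.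
have ds k : s k.+1 - s k = (b - a) / n.+1%:R.
  by rewrite /s -(natr1 k); field.
have dlt : (b - a) / n.+1%:R < Num.min d1 d2.
  move: hn; rewrite ltr_pdivlMr; last lra.
  have : 0 < (n.+1%:R : R)^-1 by rewrite invr_gt0.
  by move: (n.+1%:R^-1) => r; nra.
move: dlt; rewrite lt_min => /andP[l1 l2].
have s0 : s 0%N = a by rewrite /s mulr0 mul0r addr0.
have sn : s n.+1 = b by rewrite /s mulfK // addrC subrK.
have sm k : s k <= s k.+1.
  by rewrite -subr_ge0 ds divr_ge0 // subr_ge0.
have /ltW k1 := h1 n.+1 s s s0 sn (fun k _ =>
  And3 (lexx _) (sm k) (eq_ind_r (fun z => z < d1) l1 (ds k))).
have /ltW k2 := h2 n.+1 s s s0 sn (fun k _ =>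
  And3 (lexx _) (sm k) (eq_ind_r (fun z => z < d2) l2 (ds k))).
move: k1 k2; set S := \sum_(k < n.+1) _ => k1 k2.
have -> : v - w = (S - w) - (S - v) by rewrite opprB [RHS]addrC addrA subrK.
apply: le_trans (nrmD _ _) _; rewrite nrmN; lra.
Qed.

Lemma Riemann_integralE {X : hilbertType R} (f : R -> X) (a b : R) v :
  a <= b -> is_Riemann_integral f a b v -> Riemann_integral f a b = v.
Proof.
move=> ab hv; apply: (Riemann_integral_unique ab) (hv).
by apply: getPex; exists v.
Qed.

End Integral.

(** * The inhomogeneous part of the affine flow *)

Section Convolution.
Context {R : realType} {H : hilbertType R}.
Local Open Scope ring_scope.
Local Open Scope complex_scope.
Variables (A : unbounded_op H) (eA : R -> H -> H) (Q : H -> H) (T CA tau : R).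
Hypotheses (analytic : analytic_semigroup eA) (gen : is_generator A eA)
  (T0 : 0 < T) (cst : semigroup_constant T A eA CA) (nQ : nonneg_op Q)
  (tau0 : 0 < tau) (tauT : tau <= T).

Let bQ := nonneg_bounded nQ.

Lemma rip_expcalA r P x y : 0 <= r ->
  rip (expcalA eA r P x) y = rip (P (eA r x)) (eA r y).
Proof.
move=> r0; rewrite /expcalA /= (ripC (adjoint _ _)).
by rewrite -(rip_adjoint (semigroup_bounded analytic r0)) ripC.
Qed.

Lemma reversed_semigroup_deriv x s : s < tau ->
  curve_deriv (fun s => eA (tau - s) x) s (- A (eA (tau - s) x)).
Proof.
move=> st; have r0 : 0 < tau - s by rewrite subr_gt0.
have [_ dx] := semigroup_dom analytic gen x r0.
move=> e e0; have [d d0 hd] := dx e e0; exists d => // h hh.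
have := hd (- h); rewrite normrN => /(_ hh).
by rewrite opprD addrA rmorphN scaleNr scalerN.
Qed.

Lemma reversed_semigroup_cont x s : s <= tau ->
  curve_cont [set s | s <= tau] (fun s => eA (tau - s) x) s.
Proof.
move=> st e e0; have r0 : 0 <= tau - s by rewrite subr_ge0.
have [d d0 hd] := semigroup_cont analytic gen x r0 e0; exists d => // r /= rt rs.
apply: hd; first by rewrite /= subr_ge0.
have -> : tau - r - (tau - s) = s - r by ring.
by rewrite distrC.
Qed.

Let j x y (s : R) := rip (Q (eA (tau - s) x)) (eA (tau - s) y).

Let jC x y s : j x y s = j y x s.
Proof. by rewrite /j nonneg_sym // ripC. Qed.

Let jD x y z s : s <= tau -> j (x + y) z s = j x z s + j y z s.
Proof.
rewrite -subr_ge0 => /(semigroup_bounded analytic)[l _].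
by rewrite /j (opD l) (opD bQ.1) ripDl.
Qed.

Let jZ (r : R) x z s : s <= tau -> j (r%:C *: x) z s = r * j x z s.
Proof.
rewrite -subr_ge0 => /(semigroup_bounded analytic)[l _].
by rewrite /j (opZ l) (opZ bQ.1) ripZl.
Qed.

Let ji x z s : s <= tau -> j ('i *: x) z s = - j x ('i *: z) s.
Proof.
rewrite -subr_ge0 => /(semigroup_bounded analytic)[l _].
by rewrite /j !(opZ l) (opZ bQ.1) rip_iC.
Qed.

Let K := opnorm Q * (1 + CA) ^+ 2.

Let K0 : 0 <= K.
Proof. by rewrite mulr_ge0 ?sqr_ge0 ?opnorm_ge0. Qed.

Let itv_T s : 0 <= s <= tau -> 0 <= tau - s <= T.
Proof. by move=> /andP[h1 h2]; have := tauT; rewrite subr_ge0 h2 /=; lra. Qed.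

Let j_bound x y s : 0 <= s <= tau -> `|j x y s| <= K * nrm x * nrm y.
Proof.
move=> /itv_T sT; apply: le_trans (rip_CS _ _) _.
have h1 := semigroup_norm analytic T0 cst x sT; have h2 := semigroup_norm analytic T0 cst y sT.
have h3 := opnormP bQ (eA (tau - s) x).
rewrite (_ : K * nrm x * nrm y = (opnorm Q * ((1 + CA) * nrm x)) * ((1 + CA) * nrm y)).
  apply: ler_pM; rewrite ?nrm_ge0 //; apply: le_trans h3 _.
  by rewrite ler_wpM2l ?opnorm_ge0.
by rewrite /K; ring.
Qed.

Let j_deriv x y s : s < tau -> is_derive s 1 (j x y)
  (rip (Q (- A (eA (tau - s) x))) (eA (tau - s) y)
   + rip (Q (eA (tau - s) x)) (- A (eA (tau - s) y))).
Proof.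
move=> st; apply: is_derive_rip; last exact: reversed_semigroup_deriv.
by apply: curve_deriv_comp => //; exact: reversed_semigroup_deriv.
Qed.

Let j_integral x y : exists c, primitive_integral 0 tau (j x y) c.
Proof.
(* freezing the argument at tau extends the integrand continuously to the whole line *)
pose jj s := rip (Q (eA (tau - Num.min s tau) x)) (eA (tau - Num.min s tau) y).
have mt r : Num.min r tau <= tau by rewrite ge_min lexx orbT.
have md r t : `|Num.min r tau - Num.min t tau| <= `|r - t|.
  have [h1|h1] := leP r tau; have [h2|h2] := leP t tau => //.
  - have := ler_norm (- (r - t)); rewrite normrN => h3.
    by rewrite ler_norml; apply/andP; split; lra.
  - have := ler_norm (r - t) => h3.
    by rewrite ler_norml; apply/andP; split; lra.
  - by rewrite subrr normr0.
have cb z t D : curve_cont D (fun r => eA (tau - Num.min r tau) z) t.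
  move=> e e0; have [d d0 hd] := reversed_semigroup_cont z (mt t) e0; exists d => // s _ hs.
  by apply: hd; [exact: mt|apply: le_lt_trans hs; exact: md].
have cjj : continuous jj.
  move=> t; have : {within `[t - 1, t + 1], continuous jj}.
    apply: within_continuous_rip => s _; last exact: cb.
    by apply: curve_cont_comp => //; exact: cb.
  have t1 : t - 1 < t + 1 by lra.
  move=> /(within_continuous_continuous t1) h.
  by apply: h; rewrite in_itv /=; apply/andP; split; lra.
have [c hc] := primitive_integral_exists (ltW tau0) cjj.
exists c; move: hc => [F [dF cF ->]]; exists F; split=> // t tt.
by have := dF t tt; rewrite /jj min_l //; case/andP: tt => _ /ltW.
Qed.

Definition convolution_form x y : R := get (primitive_integral 0 tau (j x y)).
Let I := convolution_form.

Let IP x y : primitive_integral 0 tau (j x y) (I x y).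
Proof. by have [c hc] := j_integral x y; apply: getPex; exists c. Qed.

Let I_eq f x y c : (forall s, 0 < s < tau -> f s = j x y s) ->
  primitive_integral 0 tau f c -> I x y = c.
Proof.
move=> h hc; apply/esym.
exact: (primitive_integral_unique tau0 h hc (IP x y)).
Qed.

Let IC x y : I x y = I y x.
Proof. by apply: (I_eq (f := j y x)); [move=> s _; exact: jC|exact: IP]. Qed.

Let lt_le s : 0 < s < tau -> s <= tau.
Proof. by move=> /andP[_ /ltW]. Qed.

Let ID x y z : I (x + y) z = I x z + I y z.
Proof.
apply: (I_eq (f := fun s => j x z s + j y z s)).
  by move=> s /lt_le st; rewrite jD.
by apply: primitive_integralD; exact: IP.
Qed.

Let IZ (r : R) x z : I (r%:C *: x) z = r * I x z.
Proof.
apply: (I_eq (f := fun s => r * j x z s)).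
  by move=> s /lt_le st; rewrite jZ.
by apply: primitive_integralZ; exact: IP.
Qed.

Let Ii x z : I ('i *: x) z = - I x ('i *: z).
Proof.
rewrite -mulN1r; apply: (I_eq (f := fun s => -1 * j x ('i *: z) s)).
  by move=> s /lt_le st; rewrite ji // mulN1r.
by apply: primitive_integralZ; exact: IP.
Qed.

Let I_bound x y : `|I x y| <= tau * K * nrm x * nrm y.
Proof.
have [t /andP[t0 tt] ->] := primitive_integral_mean tau0 (IP x y).
rewrite subr0 normrM (gtr0_norm tau0).
have -> : tau * K * nrm x * nrm y = K * nrm x * nrm y * tau by ring.
by apply: ler_wpM2r; [exact: ltW|apply: j_bound; rewrite (ltW t0) (ltW tt)].
Qed.

(** The operator [V x = \int_0^tau e^{(tau-s)A*} Q e^{(tau-s)A} x ds] comes from its form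
    by the Riesz representation, and inherits symmetry, positivity and compatibility with
    [i] from the integrand. *)
Lemma convolution_exists : exists2 V : H -> H, nonneg_op V &
  forall x y, primitive_integral 0 tau (j x y) (rip (V x) y).
Proof.
have ex x : exists v, forall y, rip v y = I x y.
  apply: (@riesz R H (I x) (tau * K * nrm x)).
  - by move=> y z; rewrite !(IC x) ID.
  - by move=> r y; rewrite !(IC x) IZ.
  - exact: I_bound.
have [V hV] := choice ex; exists V; last by move=> x y; rewrite hV; exact: IP.
apply/nonneg_opP; split; last first.
  move=> x; rewrite hV; have [t /andP[_ tt] ->] := primitive_integral_mean tau0 (IP x x).
  rewrite subr0 mulr_ge0 ?(ltW tau0) //.
  by have [_] := (nonneg_opP Q).1 nQ; exact.
apply/selfadjoint_opP; split; last by move=> x y; rewrite hV ripC hV IC.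
split.
  apply: linear_of_real.
  - by move=> x y; apply: rip_ext => z; rewrite ripDl !hV ID.
  - by move=> r x; apply: rip_ext => z; rewrite ripZl !hV IZ.
  - by move=> x; apply: rip_ext => z; rewrite rip_iC !hV Ii.
exists (tau * K) => x; apply: nrm_le_rip.
  by apply: mulr_ge0 (nrm_ge0 _); exact: mulr_ge0 (ltW tau0) K0.
by move=> y; rewrite hV; apply: le_trans (ler_norm _) (I_bound _ _).
Qed.

(** At distance at least [r] from [tau] the semigroup is evaluated at times at least [r],
    where [A e^{tA}] is bounded by [CA / r]. *)
Lemma convolution_lipschitz x y (r a b : R) : 0 < r -> 0 <= a -> a <= b -> b <= tau - r ->
  `|j x y b - j x y a|
    <= 2 * opnorm Q * (1 + CA) * (CA / r) * nrm x * nrm y * (b - a).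
Proof.
move=> r0 a0; rewrite le_eqVlt => /orP[/eqP -> _|ab br].
  by rewrite !subrr normr0 mulr0.
have dj t : t \in `]a, b[ -> is_derive t 1 (j x y)
  (rip (Q (- A (eA (tau - t) x))) (eA (tau - t) y)
   + rip (Q (eA (tau - t) x)) (- A (eA (tau - t) y))).
  by rewrite in_itv /= => /andP[_ tb]; apply: j_deriv; lra.
have cj : {within `[a, b], continuous (j x y)}.
  apply: derivable_within_continuous => t; rewrite in_itv /= => /andP[_ tb].
  have tt : t < tau by lra.
  by have h := j_deriv x y tt; exact: ex_derive.
have [t] := MVT ab dj cj; rewrite in_itv /= => /andP[at_ tb] ->.
rewrite normrM (gtr0_norm (_ : 0 < b - a)) ?subr_gt0 // ler_wpM2r ?subr_ge0 ?(ltW ab) //.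
have tT : 0 < tau - t <= T by have h := tauT; apply/andP; split; lra.
have tT' : 0 <= tau - t <= T by case/andP: tT => /ltW -> ->.
have q0 := opnorm_ge0 bQ; have c0 := semigroup_constant_ge0 analytic T0 cst.
have cr : CA / (tau - t) <= CA / r.
  by apply: ler_wpM2l => //; rewrite lef_pV2 ?posrE //; lra.
have hA z : nrm (A (eA (tau - t) z)) <= CA / r * nrm z.
  apply: le_trans (semigroup_A_norm analytic gen cst z tT) _.
  by rewrite ler_wpM2r ?nrm_ge0.
have hN z : nrm (eA (tau - t) z) <= (1 + CA) * nrm z.
  exact: (semigroup_norm analytic T0 cst).
have hQ z w (al be : R) : 0 <= al -> nrm z <= al * nrm x -> nrm w <= be * nrm y ->
    `|rip (Q z) w| <= opnorm Q * al * be * (nrm x * nrm y).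
  move=> al0 hz hw; apply: le_trans (rip_CS _ _) _.
  rewrite (_ : opnorm Q * al * be * (nrm x * nrm y)
     = (opnorm Q * (al * nrm x)) * (be * nrm y)); last by ring.
  apply: ler_pM; rewrite ?nrm_ge0 //; apply: le_trans (opnormP bQ z) _.
  by rewrite ler_wpM2l.
have cr0 : 0 <= CA / r by rewrite divr_ge0 // ltW.
apply: le_trans (ler_normD _ _) _.
have h1 : `|rip (Q (- A (eA (tau - t) x))) (eA (tau - t) y)|
   <= opnorm Q * (CA / r) * (1 + CA) * (nrm x * nrm y).
  by apply: hQ; rewrite ?nrmN.
have h2 : `|rip (Q (eA (tau - t) x)) (- A (eA (tau - t) y))|
   <= opnorm Q * (1 + CA) * (CA / r) * (nrm x * nrm y).
  by apply: hQ; rewrite ?nrmN //; lra.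
lra.
Qed.

(** No continuity of [r |-> e^{rA*} Q e^{rA} x] at [r = 0] is used: away from [s = tau] the
    integrand is Lipschitz, and the last stretch, of length [eta], is estimated by the size
    of the integrand.  The increments of [m s = max (s - (tau - eta)) 0] measure the part of
    each subinterval that lies in that stretch, and they telescope. *)
Lemma convolution_Riemann x v :
  (forall y, primitive_integral 0 tau (j x y) (rip v y)) ->
  is_Riemann_integral (fun s => expcalA eA (tau - s) Q x) 0 tau v.
Proof.
move=> hv e e0; have q0 := opnorm_ge0 bQ; have c0 := semigroup_constant_ge0 analytic T0 cst.
set Kx := K * nrm x; have Kx0 : 0 <= Kx by apply: mulr_ge0 K0 (nrm_ge0 x).
pose eta := e / (8 * (Kx + 1)).
have eta0 : 0 < eta by rewrite divr_gt0 // mulr_gt0 //; lra.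
have eta1 : Kx * eta <= e / 8.
  rewrite /eta mulrA ler_pdivrMr; last by rewrite mulr_gt0 //; lra.
  lra.
clearbody eta.
set L := 2 * opnorm Q * (1 + CA) * (CA / (eta / 2)) * nrm x.
have L0 : 0 <= L.
  apply: mulr_ge0 (nrm_ge0 x); apply: mulr_ge0; last first.
    by apply: divr_ge0 c0 _; apply: divr_ge0 => //; exact: ltW.
  by apply: mulr_ge0; [rewrite mulr_ge0|lra].
pose d := Num.min (eta / 2) (e / (4 * (L * tau + 1))).
have Lt0 : 0 < L * tau + 1 by have := mulr_ge0 L0 (ltW tau0); lra.
have d0 : 0 < d.
  rewrite lt_min; apply/andP; split; first exact: divr_gt0.
  by apply: divr_gt0 => //; exact: mulr_gt0.
have d1 : d <= eta / 2 by rewrite ge_min lexx.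
have d2 : L * d * tau <= e / 4.
  have : d <= e / (4 * (L * tau + 1)) by rewrite ge_min lexx orbT.
  rewrite ler_pdivlMr ?mulr_gt0 // => h.
  have := mulr_ge0 L0 (ltW tau0) => h0; nra.
exists d => // n s xi s0 sn hs.
have smono k : (k < n)%N -> s k <= s k.+1 by move=> /hs[h1 h2 _]; exact: le_trans h2.
have sge k : (k <= n)%N -> 0 <= s k.
  elim: k => [|k IH] kn; first by rewrite s0.
  by apply: le_trans (smono k kn); apply: IH; exact: ltnW.
have sle k : (k <= n)%N -> s k <= tau.
  move=> kn; rewrite -(subKn kn); elim: (n - k)%N (leq_subr k n) => [|i IH] hi.
    by rewrite subn0 sn.
  apply: le_trans (IH (ltnW hi)); rewrite -(subnSK hi).
  by apply: smono; rewrite subnSK // leq_subr.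
pose m (s : R) := Num.max (s - (tau - eta)) 0.
have mmono a b : a <= b -> m a <= m b.
  by move=> ab; rewrite /m ge_max !le_max lexx orbT andbT lerB.
apply: le_lt_trans (_ : e / 2 < e); last lra.
apply: nrm_le_rip => [|y]; first by rewrite divr_ge0 // ltW.
have [F [dF cF vF]] := hv y; have y0 := nrm_ge0 y.
have step a b z : 0 <= a -> a <= z -> z <= b -> b <= tau -> b - a < d ->
   `|(b - a) * j x y z - (F b - F a)|
     <= nrm y * (L * d * (b - a) + 2 * Kx * (m b - m a)).
  move=> a0 az zb bt bad; have ab := le_trans az zb.
  have [<-|nab] := eqVneq a b; first by rewrite !subrr mul0r !mulr0 addr0 mulr0 subrr normr0.
  have {nab}ab' : a < b by rewrite lt_neqAle nab.
  have [r /andP[ar rb] ->] := primitive_integral_mean ab' (primitive_integral_sub a0 bt dF cF).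
  have -> : (b - a) * j x y z - j x y r * (b - a) = (b - a) * (j x y z - j x y r) by ring.
  rewrite normrM (gtr0_norm (_ : 0 < b - a)) ?subr_gt0 //.
  have mm := mmono _ _ ab.
  have [hb|hb] := leP b (tau - eta / 2).
    have lip : `|j x y z - j x y r| <= L * nrm y * d.
      have [zr|/ltW rz] := leP z r.
        rewrite distrC; apply: le_trans (@convolution_lipschitz x y (eta / 2) z r _ _ _ _) _ => //.
        - by rewrite divr_gt0.
        - exact: le_trans az.
        - lra.
        by apply: ler_wpM2l; [exact: mulr_ge0|lra].
      apply: le_trans (@convolution_lipschitz x y (eta / 2) r z _ _ _ _) _ => //.
      - by rewrite divr_gt0.
      - by apply: le_trans (ltW ar).
      - lra.
      by apply: ler_wpM2l; [exact: mulr_ge0|lra].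
    apply: le_trans (_ : (b - a) * (L * nrm y * d) <= _).
      by apply: ler_wpM2l => //; rewrite subr_ge0.
    have mm0 : 0 <= m b - m a by rewrite subr_ge0.
    by have := mulr_ge0 y0 (mulr_ge0 Kx0 mm0); lra.
  have mE : m b - m a = b - a.
    rewrite /m !max_l; lra.
  have big : `|j x y z - j x y r| <= 2 * (Kx * nrm y).
    apply: le_trans (ler_normB _ _) _; rewrite mulr_natl mulr2n; apply: lerD; apply: j_bound.
      by apply/andP; split; [exact: le_trans az|exact: le_trans bt].
    by apply/andP; split; [exact: le_trans (ltW ar)|exact: le_trans (ltW rb) bt].
  apply: le_trans (_ : (b - a) * (2 * (Kx * nrm y)) <= _).
    by apply: ler_wpM2l => //; rewrite subr_ge0.
  have ba0 : 0 <= b - a by rewrite subr_ge0.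
  have := mulr_ge0 y0 (mulr_ge0 (mulr_ge0 L0 (ltW d0)) ba0).
  by rewrite mE; lra.
have sum k : (k <= n)%N -> `|\sum_(i < k) (s i.+1 - s i) * j x y (xi i) - (F (s k) - F (s 0%N))|
     <= nrm y * (L * d * (s k - s 0%N) + 2 * Kx * (m (s k) - m (s 0%N))).
  elim: k => [|k IH] kn; first by rewrite big_ord0 !subrr normr0 !mulr0 addr0 mulr0.
  rewrite big_ord_recr /=; have [h1 h2 h3] := hs k kn.
  have {IH}h4 := IH (ltnW kn).
  have h5 := step _ _ _ (sge k (ltnW kn)) h1 h2 (sle _ kn) h3.
  set S := \sum_(i < k) _ in h4 *.
  have -> : S + (s k.+1 - s k) * j x y (xi k) - (F (s k.+1) - F (s 0%N))
   = (S - (F (s k) - F (s 0%N))) + ((s k.+1 - s k) * j x y (xi k) - (F (s k.+1) - F (s k))).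
    by ring.
  apply: le_trans (ler_normD _ _) _; lra.
have := sum n (leqnn n); rewrite s0 sn subr0 -vF.
have -> : \sum_(i < n) (s i.+1 - s i) * j x y (xi i) - rip v y
  = rip (\sum_(k < n) (s k.+1 - s k)%:C *: expcalA eA (tau - xi k) Q x - v) y.
  rewrite ripBl rip_suml; congr (_ - _); apply: eq_bigr => i _.
  rewrite ripZl rip_expcalA // subr_ge0.
  by have [_ h _] := hs i (ltn_ord i); apply: le_trans h (sle _ (ltn_ord i)).
move=> h; apply: le_trans (ler_norm _) _; apply: le_trans h _; rewrite mulrC.
apply: ler_wpM2r => //.
have mt : m tau - m 0 <= eta.
  have -> : m tau = eta by rewrite /m max_l; lra.
  by rewrite lerBlDr lerDl /m le_max lexx orbT.
have := ler_wpM2l Kx0 mt; lra.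
Qed.

(** Hence the affine flow is [e^{tau A*} P1 e^{tau A} + V], and paired with vectors its
    inhomogeneous part is a scalar integral that can be compared with derivatives along
    the exact solution. *)
Lemma expF_weak : exists V : H -> H,
  [/\ nonneg_op V,
      forall P1 x y, rip (expF eA Q tau P1 x) y
        = rip (P1 (eA tau x)) (eA tau y) + rip (V x) y,
      forall P1 x, expF eA Q tau P1 x = expcalA eA tau P1 x + V x
    & forall x y, primitive_integral 0 tau (j x y) (rip (V x) y)].
Proof.
have [V nV hV] := convolution_exists.
have E P1 x : expF eA Q tau P1 x = expcalA eA tau P1 x + V x.
  congr (_ + _); apply: Riemann_integralE; first exact: ltW.
  exact: convolution_Riemann.
exists V; split => // P1 x y.
by rewrite E ripDl rip_expcalA // ltW.
Qed.

End Convolution.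

(** * The flow of the quadratic part *)

Section QuadraticFlow.
Context {R : realType} {H U : hilbertType R}.
Local Open Scope ring_scope.
Local Open Scope complex_scope.

(** Differentiability in operator norm is uniform in the vector to which it is applied. *)
Lemma op_derivative_eps (D : set R) (P : R -> H -> H) t P' :
  (forall s, D s -> bounded_op (P s)) -> D t -> op_derivative D P t P' ->
  forall e : R, 0 < e -> exists2 d : R, 0 < d & forall s x, D s -> `|s - t| < d ->
    nrm (P s x - P t x - (s - t)%:C *: P' x) <= e * `|s - t| * nrm x.
Proof.
move=> bP Dt [bP' /cvgrPdist_lt hd] e e0.
move: (hd e e0); rewrite /dnbhs !near_withinE => /nbhs_ballP[d /= d0 hh].
exists d => // s x Ds hs; have [->|st] := eqVneq s t.
  by rewrite !subrr scale0r subrr nrm0 normr0 mulr0 mul0r.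
have h := hh s; rewrite /ball /= distrC in h; have {h hh} := h hs st Ds.
rewrite sub0r normrN => hop.
set q := fun x => _ in hop.
have bq : bounded_op q.
  apply: bounded_addop; last exact: bounded_oppop.
  apply: bounded_scale; apply: bounded_addop; first exact: bP.
  by apply: bounded_oppop; exact: bP.
have s0 : s - t != 0 by rewrite subr_eq0.
have -> : P s x - P t x - (s - t)%:C *: P' x = (s - t)%:C *: q x.
  by rewrite /q scalerBr scalerA -rmorphM mulfV // scale1r.
rewrite nrmZ mulrC mulrAC ler_wpM2r //.
apply: le_trans (opnormP bq x) _; rewrite ler_wpM2r ?nrm_ge0 //.
by apply: ltW; apply: le_lt_trans hop; exact: ler_norm.
Qed.

Lemma op_derivative_curve (D : set R) (P : R -> H -> H) t P' x :
  (forall s, D s -> bounded_op (P s)) -> D t -> op_derivative D P t P' ->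
  (exists2 d, 0 < d & forall h, `|h| < d -> D (t + h)) ->
  curve_deriv (fun s => P s x) t (P' x).
Proof.
move=> bP Dt dP [d0 d00 hD] e e0.
have x0 : 0 < 1 + nrm x by rewrite ltr_wpDr ?nrm_ge0.
have [d dp hd] := op_derivative_eps bP Dt dP (divr_gt0 e0 x0).
exists (Num.min d0 d) => [|h]; first by rewrite lt_min d00.
rewrite lt_min => /andP[h1 h2].
have th : t + h - t = h by rewrite addrC addKr.
have := hd (t + h) x (hD h h1); rewrite th => /(_ h2) hh.
apply: le_trans hh _; rewrite mulrAC ler_wpM2r // mulrAC ler_pdivrMr //.
by rewrite ler_wpM2l ?ltW // ltrDr.
Qed.

(** [Y = X (I + t S X)^-1 = (I + t X S)^-1 X], stated without inverses; it is the value at time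
    [t] of the solution of [Y' = - Y S Y] that starts from [X]. *)
Definition riccati_resolvent (S : H -> H) (t : R) (X Y : H -> H) :=
  forall x, Y x = X x - t%:C *: X (S (Y x)) /\ Y x = X x - t%:C *: Y (S (X x)).

(** The resolvent identity; formally [Yt^-1 - Ys^-1 = (t - s) S]. *)
Lemma riccati_resolvent_diff S s t X Ys Yt x : bounded_op S -> bounded_op X ->
  bounded_op Ys -> riccati_resolvent S s X Ys -> riccati_resolvent S t X Yt ->
  Ys x - Yt x = (t - s)%:C *: Ys (S (Yt x)).
Proof.
move=> [lS _] [lX _] [lY _] rs rt.
have XE z : X z = Ys z + s%:C *: Ys (S (X z)) by rewrite {1}(rs z).2 subrK.
have e1 : Ys (S (Yt x)) = Ys (S (X x)) - t%:C *: Ys (S (X (S (Yt x)))).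
  by rewrite [in LHS](rt x).1 (opB lS) (opB lY) (opZ lS) (opZ lY).
have e2 : Yt x = Ys x + s%:C *: Ys (S (X x))
    - t%:C *: (Ys (S (Yt x)) + s%:C *: Ys (S (X (S (Yt x))))).
  by rewrite -!XE -(rt x).1.
apply: rip_ext => z; rewrite ripBl {1}e2.
move/(congr1 (fun v => rip v z)): e1.
by rewrite !(ripBl, ripDl, ripZl) => ->; ring.
Qed.

(** From [|Y| <= |X| + t |X| |S| |Y|] the last term is absorbed in the left-hand side. *)
Lemma riccati_resolvent_bound S t X Y (c sigma : R) : 0 <= t -> 0 <= c -> 0 <= sigma ->
  bounded_by S sigma -> bounded_by X c -> t * (c * sigma) <= 2^-1 ->
  riccati_resolvent S t X Y -> bounded_by Y (2 * c).
Proof.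
move=> t0 c0 s0 hS hX ht rY x; have [e _] := rY x.
have h1 : nrm (Y x) <= nrm (X x) + t * nrm (X (S (Y x))).
  by rewrite {1}e; apply: le_trans (nrmD _ _) _; rewrite nrmN nrmZ ger0_norm.
have h2 : t * nrm (X (S (Y x))) <= t * (c * (sigma * nrm (Y x))).
  rewrite ler_wpM2l //; apply: le_trans (hX _) _.
  by rewrite ler_wpM2l.
have := hX x; have := nrm_ge0 (Y x); nra.
Qed.

Variable B : U -> H.
Hypothesis bB : bounded_op B.
Let S := B \o adjoint B.

Lemma BBadj_bounded : bounded_op S.
Proof. by apply: bounded_comp => //; exact: adjoint_bounded. Qed.
Let bS := BBadj_bounded.

Lemma BBadj_sym x y : rip (S x) y = rip x (S y).
Proof. by rewrite /S /= (rip_adjoint bB) ripC -(rip_adjoint bB) ripC. Qed.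

Lemma BBadj_ge0 x : 0 <= rip (S x) x.
Proof. by rewrite /S /= (rip_adjoint bB) -nrm_sqr sqr_ge0. Qed.

(** By the identity of Woodbury, [X (I + t B B^* X)^-1 = X - t X B (I + t B^* X B)^-1 B^* X],
    and [I + t B^* X B] is symmetric and at least [I].  Positivity of [Y]: with [z = x - t S Y x]
    one has [Y x = X z] and [<Y x, x> = <X z, z> + t <S Y x, Y x>]. *)
Lemma riccati_resolvent_exists X (t : R) : 0 <= t -> nonneg_op X ->
  exists2 Y, nonneg_op Y & riccati_resolvent S t X Y.
Proof.
move=> t0 /nonneg_opP[/selfadjoint_opP[bX sX] nX].
have bBs := adjoint_bounded bB.
(* M = I + t B^* X B *)
pose M u := u + t%:C *: adjoint B (X (B u)).
have bM : bounded_op M.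
  apply: bounded_addop; first exact: bounded_id.
  apply: bounded_scale; apply: (bounded_comp _ bBs).
  exact: (bounded_comp bB bX).
have rM u v : rip (M u) v = rip u v + t * rip (X (B u)) (B v).
  by rewrite /M ripDl ripZl (ripC (adjoint B _)) -(rip_adjoint bB) (ripC (B v)).
have [||N /selfadjoint_opP[bN sN] MN] := @coercive_inverse R U M.
- apply/selfadjoint_opP; split=> // u v.
  by rewrite rM [RHS]ripC rM sX (ripC (B u)) (ripC u).
- move=> u; rewrite rM -nrm_sqr lerDl mulr_ge0 //; exact: nX.
pose Y x := X x - t%:C *: X (B (N (adjoint B (X x)))).
have YE x : Y x = X x - t%:C *: X (S (Y x)).
  rewrite {1}/Y; congr (_ - _ *: X (B _)).
  rewrite /Y (opB bBs.1) (opZ bBs.1) -{2}(MN (adjoint B (X x))) /M.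
  by rewrite addrK.
have bY : bounded_op Y.
  apply: bounded_addop => //; apply: bounded_oppop; apply: bounded_scale.
  apply: (bounded_comp _ bX); apply: (bounded_comp _ bB).
  by apply: (bounded_comp _ bN); apply: (bounded_comp _ bBs).
have sY x y : rip (Y x) y = rip x (Y y).
  rewrite /Y ripBl ripBr ripZl ripZr sX; congr (_ - _ * _).
  by rewrite sX (rip_adjoint bB) sN (ripC (adjoint B _)) -(rip_adjoint bB) (ripC (B _)) sX.
have YE2 x : Y x = X x - t%:C *: Y (S (X x)).
  apply: rip_ext => y; rewrite ripBl ripZl sY {1}YE ripBr ripZr.
  by rewrite -!sX -BBadj_sym -sY.
exists Y; last by move=> x; split; [exact: YE|exact: YE2].
apply/nonneg_opP; split; first by apply/selfadjoint_opP.
move=> x; pose z := x - t%:C *: S (Y x).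
have XzE : X z = Y x by rewrite /z (opB bX.1) (opZ bX.1) -YE.
have xE : x = z + t%:C *: S (Y x) by rewrite subrK.
rewrite {2}xE ripDr ripZr -{1}XzE addr_ge0 // mulr_ge0 // ripC.
exact: BBadj_ge0.
Qed.

(** By the resolvent identity the difference quotient is [- Y s S (Y t)], and [Y s] stays bounded
    near [t] by the same identity. *)
Lemma riccati_resolvent_deriv X (Y : R -> H -> H) t : 0 <= t -> bounded_op X ->
  (forall s, 0 <= s -> bounded_op (Y s) /\ riccati_resolvent S s X (Y s)) ->
  op_derivative [set s | 0 <= s] Y t (fun x => - Y t (S (Y t x))).
Proof.
move=> t0 bX hY; have [bYt rYt] := hY t t0.
have bSY := bounded_comp bYt bS.
have bYSY := bounded_comp bSY bYt.
split; first exact: bounded_oppop.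
apply/cvgrPdist_le => e e0.
set y := opnorm (Y t); set sigma := opnorm S.
have y0 : 0 <= y by exact: opnorm_ge0.
have s0 : 0 <= sigma by exact: opnorm_ge0.
have c1 : 0 < 2 * (y * sigma + 1) by have := mulr_ge0 y0 s0; lra.
have c2 : 0 < 2 * y ^+ 3 * sigma ^+ 2 + 1.
  have := mulr_ge0 (exprn_ge0 3 y0) (exprn_ge0 2 s0); lra.
rewrite /dnbhs !near_withinE; apply/nbhs_ballP.
exists (Num.min (2 * (y * sigma + 1))^-1 (e / (2 * y ^+ 3 * sigma ^+ 2 + 1))).
  by rewrite /= lt_min invr_gt0 c1 divr_gt0.
move=> s; rewrite /ball /= lt_min distrC => /andP[h1 h2] st s_ge0.
have [bYs rYs] := hY s s_ge0.
have bd : bounded_by (Y s) (2 * y).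
  move=> x; have h := riccati_resolvent_diff x bS bX bYt rYt rYs.
  have e1 : Y s x = Y t x - (s - t)%:C *: Y t (S (Y s x)) by rewrite -h subKr.
  have h3 : nrm (Y s x) <= y * nrm x + `|s - t| * (y * (sigma * nrm (Y s x))).
    rewrite {1}e1; apply: le_trans (nrmD _ _) _; rewrite nrmN nrmZ.
    apply: lerD; first exact: opnormP.
    apply: ler_wpM2l => //; apply: le_trans (opnormP bYt _) _.
    by apply: ler_wpM2l => //; exact: opnormP.
  have h4 : `|s - t| * (2 * (y * sigma + 1)) <= 1.
    by rewrite -ler_pdivlMr // div1r ltW.
  have := nrm_ge0 (Y s x); have := normr_ge0 (s - t) => n0 n1.
  have : `|s - t| * (y * sigma) <= 2^-1 by nra.
  nra.
rewrite sub0r normrN ger0_norm; last first.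
  apply: opnorm_ge0; apply: bounded_addop; last by apply: bounded_oppop; exact: bounded_oppop.
  apply: bounded_scale; apply: bounded_addop => //; exact: bounded_oppop.
apply: opnorm_le; first exact: ltW.
move=> x.
have n0 : s - t != 0 by rewrite subr_eq0.
have -> : ((s - t)^-1)%:C *: (Y s x - Y t x) - - Y t (S (Y t x))
  = (s - t)%:C *: Y s (S (Y t (S (Y t x)))).
  rewrite (riccati_resolvent_diff x bS bX bYs rYs rYt) scalerA -rmorphM.
  have -> : (s - t)^-1 * (t - s) = -1 by field.
  have h := riccati_resolvent_diff (S (Y t x)) bS bX bYs rYs rYt.
  rewrite rmorphN1 scaleN1r opprK addrC -opprB h -scaleNr -rmorphN opprB //.
rewrite nrmZ.
have h3 : nrm (Y s (S (Y t (S (Y t x))))) <= 2 * y * (sigma * (y * (sigma * (y * nrm x)))).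
  apply: le_trans (bd _) _; apply: ler_wpM2l; first lra.
  apply: le_trans (opnormP bS _) _; apply: ler_wpM2l => //.
  apply: le_trans (opnormP bYt _) _; apply: ler_wpM2l => //.
  apply: le_trans (opnormP bS _) _; apply: ler_wpM2l => //.
  exact: opnormP.
move: h2; rewrite ltr_pdivlMr // => /ltW h2.
apply: le_trans (ler_wpM2l (normr_ge0 _) h3) _.
rewrite (_ : `|s - t| * _ = `|s - t| * (2 * y ^+ 3 * sigma ^+ 2) * nrm x); last by ring.
rewrite ler_wpM2r ?nrm_ge0 //; apply: le_trans h2.
by rewrite ler_wpM2l // lerDl.
Qed.

(** If [Z] solves the quadratic equation then [w s = Z s (I + s S X) x - X x] solves the linear
    equation [w' = - Z S w] with [w 0 = 0], hence vanishes; and [I + t S X] is inverted by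
    [I - t S Y]. *)
Lemma G_solution_unique X (Z : R -> H -> H) Y t : 0 <= t -> nonneg_op X ->
  G_solution S X Z -> nonneg_op Y -> riccati_resolvent S t X Y -> Z t = Y.
Proof.
move=> t0 nX [saZ Z0 dZ] nY rY.
have bZ s : 0 <= s -> bounded_op (Z s) by move=> /saZ[].
have bX := nonneg_bounded nX; have bY := nonneg_bounded nY.
suff ZE x : Z t x + t%:C *: Z t (S (X x)) = X x.
  apply/funext => x.
  have e1 : Z t (x + t%:C *: S (X x)) = X x.
    by rewrite (opD (bZ _ t0).1) (opZ (bZ _ t0).1).
  have := ZE (x - t%:C *: S (Y x)).
  rewrite (opB bX.1) (opZ bX.1) -(rY x).1.
  by rewrite (opB (bZ _ t0).1) (opZ (bZ _ t0).1) subrK.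
have [t_eq0|tn0] := eqVneq t 0; first by rewrite t_eq0 Z0 scale0r addr0.
have tp : 0 < t by rewrite lt_neqAle eq_sym tn0.
have op_cont : {within `[0, t], continuous (fun s => opnorm (Z s))}.
  apply: within_continuous_eps => s /andP[s0 _] e e0.
  have [d d0 hd] := op_derivative_eps bZ s0 (dZ s s0) ltr01.
  have bD := (dZ s s0).1; set W := (fun x => _) in bD hd.
  have o0 := opnorm_ge0 bD.
  have c0 : 0 < 1 + opnorm W by lra.
  exists (Num.min d (e / 2 / (1 + opnorm W))).
    by rewrite lt_min d0 !divr_gt0.
  move=> r /andP[r0 _]; rewrite lt_min => /andP[h1]; rewrite ltr_pdivlMr // => h2.
  apply: le_lt_trans (_ : e / 2 < e); last lra.
  apply: opnorm_lipschitz; [by rewrite divr_ge0 // ltW|exact: bZ|exact: bZ|].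
  move=> y; rewrite -[Z r y - Z s y](subrK ((r - s)%:C *: W y)).
  apply: le_trans (nrmD _ _) _; rewrite nrmZ.
  have h3 := hd r y r0 h1; have h4 := opnormP bD y.
  have h5 := ler_wpM2l (normr_ge0 (r - s)) h4.
  have h6 := ler_wpM2r (nrm_ge0 y) (ltW h2).
  rewrite -/W in h5; lra.
(* a bound of Z on the compact interval [0, t] *)
have [m _ hm] := EVT_max t0 op_cont.
set b := S (X x).
pose w s := Z s x + s%:C *: Z s b - X x.
pose w' s := - Z s (S (Z s x)) + (Z s b + s%:C *: - Z s (S (Z s b))) + - 0.
have nbh s : 0 < s -> exists2 d, 0 < d & forall h : R, `|h| < d -> 0 <= s + h.
  move=> s0; exists s => // h hs; have := ler_norm (- h); rewrite normrN; lra.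
have dcur s y : 0 < s -> curve_deriv (fun s => Z s y) s (- Z s (S (Z s y))).
  move=> s0; have s0' := ltW s0.
  exact: (op_derivative_curve y bZ s0' (dZ s s0') (nbh s s0)).
have ccur s y : 0 <= s -> curve_cont [set s | 0 <= s <= t] (fun s => Z s y) s.
  move=> s0 e e0.
  have [d d0 hd] := op_derivative_eps bZ s0 (dZ s s0) ltr01.
  have bD := (dZ s s0).1; set W := (fun x => _) in bD hd.
  have c0 : 0 < nrm (W y) + nrm y + 1.
    by have := nrm_ge0 (W y); have := nrm_ge0 y; lra.
  exists (Num.min d (e / (nrm (W y) + nrm y + 1))).
    by rewrite lt_min d0 divr_gt0.
  move=> r /andP[r0 _]; rewrite lt_min => /andP[h1]; rewrite ltr_pdivlMr // => h2.
  rewrite -[Z r y - Z s y](subrK ((r - s)%:C *: W y)).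
  apply: le_lt_trans (nrmD _ _) _; rewrite nrmZ.
  have := hd r y r0 h1; have := normr_ge0 (r - s); lra.
have wE s : 0 <= s -> w' s = - Z s (S (w s)).
  move=> /bZ[lZ _]; rewrite /w' /w (opB bS.1) (opD bS.1) (opZ bS.1).
  rewrite (opB lZ) (opD lZ) (opZ lZ) -/b.
  by apply: rip_ext => z; rewrite !(ripBl, ripDl, ripNl, ripZl, rip0l); ring.
suff : w t = 0 by rewrite /w => /eqP; rewrite subr_eq0 => /eqP.
apply: (@curve_eq0_of_deriv_le R H w w' (opnorm (Z m) * opnorm S) t tp).
- move=> s /andP[s0 _]; apply: curve_derivD.
    apply: curve_derivD; first exact: dcur.
    by apply: curve_derivX; exact: dcur.
  by apply: curve_derivN; exact: curve_deriv_cst.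
- move=> s /andP[s0 st]; rewrite wE ?(ltW s0) // nrmN.
  apply: le_trans (opnormP (bZ s (ltW s0)) _) _.
  rewrite -mulrA; apply: ler_pM; rewrite ?nrm_ge0 ?opnorm_ge0 //.
  + exact: bZ (ltW s0).
  + by apply: hm; rewrite in_itv /= (ltW s0) (ltW st).
  + exact: opnormP.
- move=> s /andP[s0 st] e e0.
  have e2 : 0 < e / 2 by rewrite divr_gt0.
  have [d1 d10 h1] := ccur s x s0 _ e2.
  have s1 : 0 < `|t| + 1 by rewrite ltr_wpDl.
  have [d2 d20 h2] := ccur s b s0 _ (divr_gt0 e2 (mulr_gt0 (ltr0Sn R 1) s1)).
  have c0 : 0 < 4 * (nrm (Z s b) + 1) by have := nrm_ge0 (Z s b); lra.
  exists (Num.min (Num.min d1 d2) (e / (4 * (nrm (Z s b) + 1)))).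
    by rewrite !lt_min d10 d20 divr_gt0.
  move=> r /= rt; rewrite !lt_min => /andP[/andP[k1 k2]].
  rewrite ltr_pdivlMr // => k3.
  have {}h1 := h1 r rt k1; have {}h2 := h2 r rt k2.
  have -> : w r - w s = (Z r x - Z s x) + (r%:C *: (Z r b - Z s b) + (r - s)%:C *: Z s b).
    by apply: rip_ext => z; rewrite /w !(ripBl, ripDl, ripNl, ripZl); ring.
  apply: le_lt_trans (nrmD _ _) _.
  apply: le_lt_trans (lerD (lexx _) (nrmD _ _)) _; rewrite !nrmZ.
  have [r0 rt'] := andP rt.
  move: h2; rewrite ltr_pdivlMr ?mulr_gt0 // => h2.
  have h3 : `|r| <= `|t| by rewrite !ger0_norm.
  have h4 := ler_wpM2r (nrm_ge0 (Z r b - Z s b)) h3.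
  have := nrm_ge0 (Z r b - Z s b); have := nrm_ge0 (Z s b).
  have := normr_ge0 (r - s); lra.
- by rewrite /w Z0 scale0r addr0 subrr.
Qed.

Lemma expGP X t : 0 <= t -> nonneg_op X ->
  nonneg_op (expG S t X) /\ riccati_resolvent S t X (expG S t X).
Proof.
move=> t0 nX.
have ex (s : R) : exists Y, 0 <= s -> nonneg_op Y /\ riccati_resolvent S s X Y.
  have [s0|s0] := leP 0 s; last by exists X.
  by have [Y nY rY] := riccati_resolvent_exists s0 nX; exists Y.
have [Y hY] := choice ex.
have Y0 : Y 0 = X.
  have [_ r0] := hY 0 (lexx 0); apply/funext => x.
  by rewrite (r0 x).1 scale0r subr0.
have GY : G_solution S X Y.
  split=> // s s0; first by case: (hY s s0) => -[].
  apply: (riccati_resolvent_deriv s0 (nonneg_bounded nX)) => r r0.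
  by have [/nonneg_bounded] := hY r r0.
have : exists2 Z, G_solution S X Z & expG S t X = Z t.
  by apply: (@getPex _ (fun X1 => exists2 Z, G_solution S X Z & X1 = Z t)); exists (Y t), Y.
move=> [Z GZ ->]; have [nY rY] := hY t t0.
by rewrite (G_solution_unique t0 nX GZ nY rY).
Qed.

End QuadraticFlow.

(** * The exact solution along one step *)

Section LocalError.
Context {R : realType} {H : hilbertType R}.
Local Open Scope ring_scope.
Local Open Scope complex_scope.

(** A bound of [2 ||P A S P + Q S P - P S P S P||]; the three summands are the terms of the
    derivative in the lemma on the commutator defect below. *)
Definition defect_rate (p s q a : R) : R :=
  2 * (p ^+ 2 * a + p * q * s + p ^+ 3 * s ^+ 2).

Variables (A : unbounded_op H) (eA : R -> H -> H) (Q S P0 : H -> H)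
  (P : R -> H -> H) (T CA : R).
Hypotheses (analytic : analytic_semigroup eA) (gen : is_generator A eA)
  (T0 : 0 < T) (cst : semigroup_constant T A eA CA) (nQ : nonneg_op Q)
  (bS : bounded_op S) (sS : forall x y, rip (S x) y = rip x (S y))
  (domS : forall x, dom A (S x)) (bAS : bounded_op (A \o S))
  (nP0 : nonneg_op P0) (sol : Riccati_solution T A Q S P0 P).

Let p := sup_norm T P.
Let bQ := nonneg_bounded nQ.

Lemma solution_bounded t : 0 <= t <= T -> bounded_op (P t).
Proof. by case: sol => -[h _ _] _ _ /h[]. Qed.

Lemma solution_sym t x y : 0 <= t <= T -> rip (P t x) y = rip x (P t y).
Proof. by case: sol => -[h _ _] _ _ /h/selfadjoint_opP[]. Qed.

(** Only times before [T] start a step, and at time [0] positivity comes from the initial value. *)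
Lemma solution_nonneg t : 0 <= t < T -> nonneg_op (P t).
Proof.
case: sol => _ PE h /andP[]; rewrite le_eqVlt => /orP[/eqP <- _|t0 tT].
  by rewrite PE.
by have [|] := h t; rewrite ?t0.
Qed.

Lemma solution_cont t x : 0 <= t <= T ->
  curve_cont [set s | 0 <= s <= T] (fun s => P s x) t.
Proof.
move=> tT e e0; case: sol => -[_ /(_ x)/subspace_continuousP hc _] _ _.
have {}hc : P s x @[s --> within `[0, T]%classic (nbhs t)] --> P t x.
  by apply: hc; rewrite /= in_itv.
move/cvgrPdist_lt: hc => /(_ e%:C); rewrite ltcR => /(_ e0).
rewrite near_withinE => /nbhs_ballP[d /= d0 hd]; exists d => // s sT hs.
have := hd s; rewrite /ball /= distrC => /(_ hs); rewrite in_itv /= => /(_ sT).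
by rewrite normE ltcR nrmB.
Qed.

Lemma opnorm_le_sup t : 0 < t < T -> opnorm (P t) <= p.
Proof.
move=> tT; case: sol => -[_ _ hb] _ _; apply: ub_le_sup => //.
by exists t => //=; rewrite in_itv.
Qed.

Lemma sup_norm_ge0 : 0 <= p.
Proof.
have h : 0 < T / 2 < T by have h := T0; apply/andP; split; lra.
apply: le_trans (opnorm_le_sup h); apply: opnorm_ge0; apply: solution_bounded.
by case/andP: h => /ltW -> /ltW ->.
Qed.

(** The supremum in [sup_norm] runs over the open interval; the end points are reached by strong
    continuity. *)
Lemma solution_norm t : 0 <= t <= T -> bounded_by (P t) p.
Proof.
move=> tT x; apply/ler_addgt0Pl => e e0.
have [d d0 hd] := solution_cont x tT e0.
have [s [sT ts]] : exists s, 0 < s < T /\ `|s - t| < d.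
  have [t0 tT'] := andP tT.
  have T0' := T0; pose r := Num.min (d / 2) (T / 2).
  have r0 : 0 < r by rewrite lt_min !divr_gt0.
  have r1 : r <= d / 2 by rewrite ge_min lexx.
  have r2 : r <= T / 2 by rewrite ge_min lexx orbT.
  have [tl|tl] := leP t (T / 2).
    have [t00|tn] := eqVneq t 0.
      by exists r; rewrite t00 subr0 gtr0_norm //; split; [apply/andP; split; lra|lra].
    exists t; rewrite subrr normr0; split => //.
    by apply/andP; split; [rewrite lt_neqAle eq_sym tn|lra].
  exists (t - r / 2); split; first by apply/andP; split; lra.
  by rewrite (_ : t - r / 2 - t = - (r / 2)) ?normrN ?gtr0_norm; lra.
have sT' : 0 <= s <= T by case/andP: sT => /ltW -> /ltW ->.
have := hd s sT' ts => h1.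
have h2 := opnormP (solution_bounded sT') x.
have h3 := ler_wpM2r (nrm_ge0 x) (opnorm_le_sup sT).
rewrite -[P t x](subKr (P s x)); apply: le_trans (nrmD _ _) _; rewrite nrmN; lra.
Qed.

Lemma solution_deriv_eps t : 0 < t < T -> exists X,
  [/\ bounded_op (fun x => X x + Q x - P t (S (P t x))),
   forall x y, dom A x -> dom A y ->
     rip (X x) y = rip (P t x) (A y) + rip (A x) (P t y) &
   forall e : R, 0 < e -> exists2 d : R, 0 < d & forall h x, `|h| < d ->
    nrm (P (t + h) x - P t x - h%:C *: (X x + Q x - P t (S (P t x))))
      <= e * `|h| * nrm x].
Proof.
move=> tT; case: sol => _ _ /(_ t tT)[_ _ [X [_ _ hX] dP]]; exists X; split.
- by case: dP.
- by move=> x y dx dy; rewrite /rip hX // /phi ReD.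
move=> e e0; have [t0 tT'] := andP tT.
have bP s : `]0, T[%classic s -> bounded_op (P s).
  by rewrite /= in_itv /= => /andP[h1 h2]; apply: solution_bounded; rewrite !ltW.
have Dt : `]0, T[%classic t by rewrite /= in_itv.
have [d d0 hd] := op_derivative_eps bP Dt dP e0.
exists (Num.min d (Num.min t (T - t))).
  by rewrite !lt_min d0 t0 subr_gt0.
move=> h x; rewrite !lt_min => /andP[h1 /andP[h2 h3]].
have th : t + h - t = h by rewrite addrC addKr.
have Dh : `]0, T[%classic (t + h).
  rewrite /= in_itv /=; have := ler_norm h; have := ler_norm (- h); rewrite normrN.
  by move=> n1 n2; apply/andP; split; lra.
by have := hd (t + h) x Dh; rewrite th; exact.
Qed.

Lemma solution_app_cont t tau (u : R -> H) s : 0 <= t -> t + tau <= T ->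
  0 <= s <= tau -> curve_cont [set s | 0 <= s <= tau] u s ->
  curve_cont [set s | 0 <= s <= tau] (fun s => P (t + s) (u s)) s.
Proof.
move=> t0 tT /andP[s0 st] cu e e0.
have tsT : 0 <= t + s <= T by apply/andP; split; lra.
have p1 : 0 < p + 1 by have := sup_norm_ge0; lra.
have e2 : 0 < e / 2 by rewrite divr_gt0.
have [d1 d10 h1] := solution_cont (u s) tsT e2.
have [d2 d20 h2] := cu _ (divr_gt0 e2 p1).
exists (Num.min d1 d2) => [|r /= /[dup] rD /andP[r0 rt]]; first by rewrite lt_min d10.
rewrite lt_min => /andP[l1 l2].
have trT : 0 <= t + r <= T by apply/andP; split; lra.
have {}h1 := h1 (t + r) trT.
have h3 : `|t + r - (t + s)| < d1 by rewrite opprD addrACA subrr add0r.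
have {h1 h3} h1 := h1 h3; have {}h2 := h2 r rD l2.
have -> : P (t + r) (u r) - P (t + s) (u s)
  = P (t + r) (u r - u s) + (P (t + r) (u s) - P (t + s) (u s)).
  by rewrite (opB (solution_bounded trT).1) addrA subrK.
apply: le_lt_trans (nrmD _ _) _.
have h4 := solution_norm trT (u r - u s).
move: h2; rewrite ltr_pdivlMr // => h2; have := nrm_ge0 (u r - u s); lra.
Qed.

Let M := 1 + CA.
Let sigma := opnorm S.
Let q := opnorm Q.
Let a := opnorm (A \o S).

(** The heart of the matter.  With [u s = e^{(tau-s)A} x], [v s = e^{(tau-s)A} y] and
    [g s = <S P u, P v>] at time [t + s], the equation gives
    [d/ds <P u, v> = <Q u, v> - g s].  The derivative of [g] is bounded uniformly up to
    [t = 0]: in [(P u)' = - PAu + (A* P + P A) u + Q u - P S P u] the unbounded terms [P A u]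
    cancel, and [A* P u] is paired with [S P v], which lies in the domain of [A]; so only
    [A S] appears.  Replacing [g s] by [g 0] therefore costs [O(tau^2)]. *)
Lemma commutator_defect t tau V x y : 0 <= t -> 0 < tau -> t + tau <= T ->
  primitive_integral 0 tau (fun s => rip (Q (eA (tau - s) x)) (eA (tau - s) y))
    (rip (V x) y) ->
  `|rip (P (t + tau) x) y - rip (P t (eA tau x)) (eA tau y) - rip (V x) y
    + tau * rip (S (P t (eA tau x))) (P t (eA tau y))|
   <= defect_rate p sigma q a * (M * nrm x) * (M * nrm y) * tau ^+ 2.
Proof.
move=> t0 tau0 ttT hV; set u0 := eA tau x; set v0 := eA tau y.
have tauT : tau <= T by lra.
pose u z s := eA (tau - s) z; pose w z s := P (t + s) (u z s).
have p0 := sup_norm_ge0; have sigma_ge0 : 0 <= sigma by exact: opnorm_ge0.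
have q0 : 0 <= q by exact: opnorm_ge0.
have a0 : 0 <= a by exact: opnorm_ge0.
have un z s : 0 <= s <= tau -> nrm (u z s) <= M * nrm z.
  move=> /andP[s0 st]; apply: (semigroup_norm analytic T0 cst); rewrite subr_ge0 st /=; lra.
have tsT s : 0 <= s <= tau -> 0 <= t + s <= T.
  by move=> /andP[s0 st]; apply/andP; split; lra.
have wn z s : 0 <= s <= tau -> nrm (w z s) <= p * (M * nrm z).
  move=> st; apply: le_trans (solution_norm (tsT s st) _) _.
  by apply: ler_wpM2l => //; exact: un.
have uc z s : 0 <= s <= tau -> curve_cont [set s | 0 <= s <= tau] (u z) s.
  move=> /andP[_ st] e e0; have [d d0 hd] := reversed_semigroup_cont analytic gen z st e0.
  by exists d => // r /= /andP[_ rt]; exact: hd.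
have wc z s : 0 <= s <= tau -> curve_cont [set s | 0 <= s <= tau] (w z) s.
  by move=> st; apply: solution_app_cont => //; exact: uc.
pose g s := rip (S (w x s)) (w y s).
have lt2le s : 0 < s < tau -> 0 <= s <= tau by move=> /andP[/ltW -> /ltW ->].
(* w' is described by its pairings with the domain of A; there A* P u becomes P u against A v *)
have wd s : 0 < s < tau -> exists w' : H -> H,
    (forall z, curve_deriv (w z) s (w' z)) /\
    (forall z v, dom A v -> rip (w' z) v =
       rip (w z s) (A v) + rip (Q (u z s)) v - rip (S (w z s)) (P (t + s) v)).
  move=> /[dup] /lt2le /tsT tsT' /andP[s0 st].
  have ts : 0 < t + s < T by apply/andP; split; lra.
  have [X [bX hX dX]] := solution_deriv_eps ts.
  have bP := solution_bounded tsT'.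
  exists (fun z => X (u z s) + Q (u z s) - P (t + s) (S (P (t + s) (u z s)))
     + P (t + s) (- A (u z s))); split.
    move=> z; have du := reversed_semigroup_deriv analytic gen z st.
    exact: (curve_deriv_app bP bX dX du).
  move=> z v dv; have ds : 0 < tau - s by rewrite subr_gt0.
  have [du _] := semigroup_dom analytic gen z ds.
  rewrite (opN bP.1) !(ripBl, ripDl, ripNl) (hX _ _ du dv).
  rewrite (solution_sym _ v tsT') (solution_sym (A (u z s)) v tsT').
  rewrite /w; ring.
have fI : primitive_integral 0 tau (fun s => rip (Q (u x s)) (u y s) - g s)
    (rip (P (t + tau) x) y - rip (P t u0) v0).
  exists (fun s => rip (w x s) (u y s)); split.
  - move=> s /[dup] s_itv /andP[s0 st].
    have [w' [dw w'E]] := wd s s_itv.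
    have ds : 0 < tau - s by rewrite subr_gt0.
    have [dv _] := semigroup_dom analytic gen y ds.
    have := is_derive_rip (dw x) (reversed_semigroup_deriv analytic gen y st).
    rewrite (w'E x _ dv) ripNr -/(u y s) => h.
    apply: is_derive_eq; rewrite /g /w; ring.
  - by apply: within_continuous_rip => s st; [exact: wc|exact: uc].
  - by rewrite /w /u subrr !(semigroup0 analytic) addr0 subr0.
have gd (s : R) : 0 < s < tau -> exists2 g' : R, is_derive s 1 g g' &
    `|g'| <= defect_rate p sigma q a * (M * nrm x) * (M * nrm y).
  move=> /[dup] /lt2le sle s_itv; have [w' [dw w'E]] := wd s s_itv.
  exists (rip (S (w' x)) (w y s) + rip (S (w x s)) (w' y)).
    apply: is_derive_rip; last exact: dw.
    by apply: (curve_deriv_comp bS); exact: dw.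
  have bnd z v : `|rip (w' z) (S (w v s))| <=
     (p ^+ 2 * a + p * q * sigma + p ^+ 3 * sigma ^+ 2) * (M * nrm z) * (M * nrm v).
    rewrite (w'E z _ (domS _)).
    have wz := wn z s sle; have wv := wn v s sle; have uz := un z s sle.
    have Mz : 0 <= M * nrm z := le_trans (nrm_ge0 _) uz.
    have Mv : 0 <= M * nrm v := le_trans (nrm_ge0 _) (un v s sle).
    have Swv : nrm (S (w v s)) <= sigma * (p * (M * nrm v)).
      by apply: le_trans (opnormP bS _) _; exact: ler_wpM2l.
    have b1 : `|rip (w z s) (A (S (w v s)))| <= (p * (M * nrm z)) * (a * (p * (M * nrm v))).
      apply: le_trans (rip_CS _ _) _; apply: ler_pM; rewrite ?nrm_ge0 //.
      by apply: le_trans (opnormP bAS (w v s)) _; exact: ler_wpM2l.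
    have b2 : `|rip (Q (u z s)) (S (w v s))| <= (q * (M * nrm z)) * (sigma * (p * (M * nrm v))).
      apply: le_trans (rip_CS _ _) _; apply: ler_pM; rewrite ?nrm_ge0 //.
      by apply: le_trans (opnormP bQ _) _; exact: ler_wpM2l.
    have b3 : `|rip (S (w z s)) (P (t + s) (S (w v s)))|
       <= (sigma * (p * (M * nrm z))) * (p * (sigma * (p * (M * nrm v)))).
      apply: le_trans (rip_CS _ _) _; apply: ler_pM; rewrite ?nrm_ge0 //.
        by apply: le_trans (opnormP bS _) _; exact: ler_wpM2l.
      by apply: le_trans (solution_norm (tsT s sle) _) _; exact: ler_wpM2l.
    apply: le_trans (ler_normB _ _) _.
    apply: le_trans (lerD (ler_normD _ _) (lexx _)) _.
    by lra.
  apply: le_trans (ler_normD _ _) _.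
  have := bnd x y; have := bnd y x.
  rewrite (sS (w' x)) (ripC (S (w x s))) /defect_rate; lra.
have [r /andP[r0 rt]] := primitive_integral_mean tau0
  (primitive_integralD fI (primitive_integralZ (-1) hV)).
rewrite subr0 -/(u x r) -/(u y r) => e1.
have -> : rip (P (t + tau) x) y - rip (P t u0) v0 - rip (V x) y
    + tau * rip (S (P t u0)) (P t v0) = - (tau * (g r - g 0)).
  have -> : g 0 = rip (S (P t u0)) (P t v0) by rewrite /g /w /u subr0 addr0.
  lra.
have g_cont : {within `[0, r], continuous g}.
  apply: within_continuous_rip => s /andP[s0 sr].
    have sle : 0 <= s <= tau by apply/andP; split; lra.
    move=> e e0; have [d d0 hd] := curve_cont_comp bS (wc x s sle) e0.
    by exists d => // z /= /andP[z0 zr]; apply: hd; apply/andP; split; lra.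
  have sle : 0 <= s <= tau by apply/andP; split; lra.
  move=> e e0; have [d d0 hd] := wc y s sle _ e0.
  by exists d => // z /= /andP[z0 zr]; apply: hd; apply/andP; split; lra.
pose g' (s : R) : R := get (is_derive s 1 g).
have hg' (s : R) : s \in `]0, r[ -> is_derive s 1 g (g' s).
  rewrite in_itv /= => /andP[s0 sr].
  have [|l hl _] := gd s; first by apply/andP; split; lra.
  by apply: getPex; exists l.
have [c] := MVT r0 hg' g_cont; rewrite in_itv /= => /[dup] c_itv /andP[c0 cr] ->.
rewrite subr0 normrN !normrM (gtr0_norm tau0) (gtr0_norm r0).
have [|l hl lb] := gd c; first by apply/andP; split; lra.
have -> : g' c = l.
  by case: (hg' c c_itv) => _ <-; case: hl => _ <-.
have lr : `|l| * r <= defect_rate p sigma q a * (M * nrm x) * (M * nrm y) * tau.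
  by apply: ler_pM => //; exact: ltW.
have := ler_wpM2l (ltW tau0) lr; lra.
Qed.

End LocalError.

(** * Stability of one step and the error recursion *)

Section Global.
Context {R : realType} {H U Y : hilbertType R}.
Local Open Scope ring_scope.
Local Open Scope complex_scope.

(** With [X] and [Z] the two starting values,
    [Yx - Yz = (I - t Yx S) (X - Z) (I - t S Yz)]: one step of the quadratic flow changes a
    difference only by a term of size [t]. *)
Lemma riccati_resolvent_stability (S X Z Yx Yz : H -> H) (t c sigma g : R) u v :
  0 <= t -> 0 <= c -> 0 <= g -> bounded_op S -> (forall x y, rip (S x) y = rip x (S y)) ->
  bounded_op X -> bounded_op Z -> nonneg_op Yx ->
  riccati_resolvent S t X Yx -> riccati_resolvent S t Z Yz ->
  bounded_by S sigma -> 0 <= sigma -> bounded_by Yx (2 * c) -> bounded_by Yz (2 * c) ->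
  t * (c * sigma) <= 2^-1 ->
  (forall x y, `|rip (X x - Z x) y| <= g * nrm x * nrm y) ->
  `|rip (Yx u - Yz u) v - rip (X u - Z u) v| <= t * (6 * c * sigma) * g * nrm u * nrm v.
Proof.
move=> t0 c0 g0 bS sS bX bZ nYx rX rZ hS s0 hYx hYz tc hD.
have bYx := nonneg_bounded nYx.
(* X z paired with (I - t S Yx) v is Yx z paired with v, and Z ((I - t S Yz) u) is Yz u *)
pose p := S (Yz u); pose r := S (Yx v).
have E : rip (Yx u - Yz u) v =
  rip (X (u - t%:C *: p) - Z (u - t%:C *: p)) (v - t%:C *: r).
  have Zu : Z (u - t%:C *: p) = Yz u.
    by rewrite (opB bZ.1) (opZ bZ.1) -(rZ u).1.
  have sym z : rip (X z) (v - t%:C *: r) = rip (Yx z) v.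
    rewrite (rX z).2 ripBr ripBl ripZl ripZr /r -sS -(nonneg_sym _ _ nYx) //.
  rewrite ripBl (ripBl (X _)) sym Zu (opB bYx.1) (opZ bYx.1).
  rewrite !ripBl !ripBr ripZl ripZr /r -(sS (Yz u)) -(nonneg_sym _ _ nYx) /p; ring.
have np : nrm p <= sigma * (2 * c) * nrm u.
  by apply: le_trans (hS _) _; rewrite -mulrA ler_wpM2l //; exact: hYz.
have nr : nrm r <= sigma * (2 * c) * nrm v.
  by apply: le_trans (hS _) _; rewrite -mulrA ler_wpM2l //; exact: hYx.
have -> : rip (Yx u - Yz u) v - rip (X u - Z u) v
  = - t * (rip (X p - Z p) v + rip (X u - Z u) r - t * rip (X p - Z p) r).
  rewrite E (opB bX.1) (opB bZ.1) !(opZ bX.1) !(opZ bZ.1).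
  rewrite !(ripBl, ripBr, ripZl, ripZr); ring.
rewrite normrM normrN (ger0_norm t0) -!mulrA; apply: ler_wpM2l => //.
have s2c : 0 <= sigma * (2 * c) by rewrite mulr_ge0 // mulr_ge0.
have nu := nrm_ge0 u; have nv := nrm_ge0 v.
have h1 : `|rip (X p - Z p) v| <= g * (sigma * (2 * c) * nrm u) * nrm v.
  by apply: le_trans (hD _ _) _; apply: ler_wpM2r => //; apply: ler_wpM2l.
have h2 : `|rip (X u - Z u) r| <= g * nrm u * (sigma * (2 * c) * nrm v).
  by apply: le_trans (hD _ _) _; apply: ler_wpM2l => //; apply: mulr_ge0.
have h3 : `|rip (X p - Z p) r| <= g * (sigma * (2 * c) * nrm u) * (sigma * (2 * c) * nrm v).
  apply: le_trans (hD _ _) _; apply: ler_pM => //; try exact: nrm_ge0.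
    by apply: mulr_ge0 => //; exact: nrm_ge0.
  by apply: ler_wpM2l.
have h4 := ler_wpM2l t0 h3.
apply: le_trans (ler_normB _ _) _.
apply: le_trans (lerD (ler_normD _ _) (lexx _)) _.
rewrite normrM (ger0_norm t0).
have h5 : 0 <= g * sigma * c * nrm u * nrm v by rewrite !mulr_ge0.
have h6 := ler_wpM2r h5 tc.
lra.
Qed.

(** [g n = b (1 + (1 + c) + ... + (1 + c)^(n-1)) <= b n (1 + c)^n] and [1 + c <= exp c]. *)
Lemma discrete_gronwall (g : nat -> R) (b c : R) (n : nat) : 0 <= b -> 0 <= c ->
  g 0%N = 0 -> (forall k, g k.+1 = g k * (1 + c) + b) ->
  g n <= b * n%:R * expR (c * n%:R).
Proof.
move=> b0 c0 g0 gS.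
have h : g n <= b * n%:R * (1 + c) ^+ n.
  elim: n => [|n IH]; first by rewrite g0 mulr0 mul0r.
  rewrite gS exprS -natr1.
  have e1 : 1 <= (1 + c) * (1 + c) ^+ n.
    by rewrite -exprS; apply: exprn_ege1; lra.
  have e2 := ler_wpM2r (_ : 0 <= 1 + c) IH.
  have := e2 ltac:(lra); have := ler_wpM2l b0 e1; lra.
apply: le_trans h _; apply: ler_wpM2l; first by rewrite mulr_ge0.
rewrite expRM_natr.
apply: lerXn2r; rewrite ?nnegrE ?expR_ge0 //; first lra.
exact: expR_ge1Dx.
Qed.
End Global.

(** * Convergence of the Lie splitting *)

Section Convergence.
Context {R : realType} {H U : hilbertType R}.
Local Open Scope ring_scope.
Local Open Scope complex_scope.

Definition defect_const (p s q a : R) : R := defect_rate p s q a + 2 * p ^+ 3 * s ^+ 2.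

(** The final [+ 1] makes the constant positive even if all data vanish. *)
Definition error_const (p T s q a C : R) : R :=
  (1 + C) ^+ 4 * defect_const p s q a * T
    * expR ((1 + C) ^+ 2 * (6 * (p + 1) * s) * T) + 1.

(** A step below this bound satisfies [tau (p + 1) s <= 1/2], the smallness condition for the
    quadratic flow, and keeps the error, hence the distance of the iterates from the exact
    solution, at most [1]. *)
Definition max_step (p T s q a C : R) : R :=
  (error_const p T s q a C + 2 * (p + 1) * s)^-1.

Variables (A : unbounded_op H) (eA : R -> H -> H) (Q : H -> H) (B : U -> H)
  (P0 : H -> H) (P : R -> H -> H) (T CA : R).
Let S := B \o adjoint B.
Hypotheses (analytic : analytic_semigroup eA) (gen : is_generator A eA)
  (T0 : 0 < T) (cst : semigroup_constant T A eA CA) (nQ : nonneg_op Q)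
  (bB : bounded_op B)
  (domS : forall x, dom A (S x)) (bAS : bounded_op (A \o S))
  (nP0 : nonneg_op P0) (sol : Riccati_solution T A Q S P0 P).

Let p := sup_norm T P.
Let sigma := opnorm S.
Let q := opnorm Q.
Let a := opnorm (A \o S).
Let M := 1 + CA.
Let bS : bounded_op S := BBadj_bounded bB.
Let sS x y : rip (S x) y = rip x (S y) := BBadj_sym bB x y.
Let p0 : 0 <= p := sup_norm_ge0 T0 sol.
Let sigma_ge0 : 0 <= sigma := opnorm_ge0 bS.
Let q0 : 0 <= q := opnorm_ge0 (nonneg_bounded nQ).
Let a0 : 0 <= a := opnorm_ge0 bAS.
Let M1 : 1 <= M. Proof. by rewrite /M lerDl; exact: (semigroup_constant_ge0 analytic T0 cst). Qed.

Lemma defect_const_ge0 : 0 <= defect_const p sigma q a.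
Proof.
have h1 := mulr_ge0 (exprn_ge0 2 p0) a0.
have h2 := mulr_ge0 (mulr_ge0 p0 q0) sigma_ge0.
have h3 := mulr_ge0 (exprn_ge0 3 p0) (exprn_ge0 2 sigma_ge0).
rewrite /defect_const /defect_rate; lra.
Qed.

(** The rectangle-rule error of the commutator defect, plus the replacement of [X - tau X S X] by
    the exact quadratic flow, whose error is [- tau^2 X S X S Y]. *)
Lemma lie_local_error (t tau : R) V Y x y : 0 <= t -> 0 < tau -> t + tau <= T ->
  tau * (p * sigma) <= 2^-1 -> nonneg_op Y -> riccati_resolvent S tau (P t) Y ->
  primitive_integral 0 tau (fun s => rip (Q (eA (tau - s) x)) (eA (tau - s) y))
    (rip (V x) y) ->
  `|rip (P (t + tau) x) y - rip (Y (eA tau x)) (eA tau y) - rip (V x) y|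
   <= defect_const p sigma q a * tau ^+ 2 * (M * nrm x) * (M * nrm y).
Proof.
move=> t0 tau0 ttT hst nY rY hV.
have h1 := commutator_defect analytic gen T0 cst nQ bS sS domS bAS sol t0 tau0 ttT hV.
set u0 := eA tau x in h1 *; set v0 := eA tau y in h1 *.
have tauT : 0 <= tau <= T by apply/andP; split; lra.
have nu : nrm u0 <= M * nrm x by exact: (semigroup_norm analytic T0 cst).
have nv : nrm v0 <= M * nrm y by exact: (semigroup_norm analytic T0 cst).
have tT : 0 <= t <= T by apply/andP; split; lra.
have nX := solution_norm T0 sol tT.
have bX := solution_bounded sol tT.
have hS := opnormP bS.
have hY := riccati_resolvent_bound (ltW tau0) p0 sigma_ge0 hS nX hst rY.
pose r := P t (S (P t (S (Y u0)))).
have e1 : rip (P t u0) v0 - rip (Y u0) v0 - tau * rip (S (P t u0)) (P t v0)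
   = - tau ^+ 2 * rip r v0.
  have e2 : P t u0 - Y u0 = tau%:C *: P t (S (Y u0)).
    by rewrite [X in _ - X = _](rY u0).1 subKr.
  have e3 : P t (S (Y u0)) = P t (S (P t u0)) - tau%:C *: r.
    by rewrite [in LHS](rY u0).1 (opB bS.1) (opB bX.1) (opZ bS.1) (opZ bX.1).
  rewrite -ripBl e2 ripZl e3 ripBl ripZl -(solution_sym sol _ _ tT); ring.
have Mx : 0 <= M * nrm x := le_trans (nrm_ge0 _) nu.
have My : 0 <= M * nrm y := le_trans (nrm_ge0 _) nv.
have hr : `|rip r v0| <= (p * (sigma * (p * (sigma * (2 * p * (M * nrm x)))))) * (M * nrm y).
  apply: le_trans (rip_CS _ _) _; apply: ler_pM; rewrite ?nrm_ge0 //.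
  apply: le_trans (nX _) _; apply: ler_wpM2l => //.
  apply: le_trans (hS _) _; apply: ler_wpM2l => //.
  apply: le_trans (nX _) _; apply: ler_wpM2l => //.
  apply: le_trans (hS _) _; apply: ler_wpM2l => //.
  apply: le_trans (hY _) _; apply: ler_wpM2l => //.
  by rewrite mulr_ge0.
have h2 := ler_wpM2l (exprn_ge0 2 (ltW tau0)) hr.
have -> : rip (P (t + tau) x) y - rip (Y u0) v0 - rip (V x) y
  = (rip (P (t + tau) x) y - rip (P t u0) v0 - rip (V x) y
      + tau * rip (S (P t u0)) (P t v0)) + - tau ^+ 2 * rip r v0.
  rewrite -e1; ring.
apply: le_trans (ler_normD _ _) _.
rewrite normrM normrN (ger0_norm (exprn_ge0 2 (ltW tau0))).
apply: le_trans (lerD h1 h2) _; rewrite /defect_const -/M -/p -/sigma -/q -/a.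
move: (defect_rate p sigma q a) (M * nrm x) (M * nrm y) => D m1 m2.
rewrite le_eqVlt; apply/orP; left; apply/eqP; ring.
Qed.

Lemma lie_nonneg (tau : R) X : 0 < tau -> tau <= T -> nonneg_op X ->
  nonneg_op (Lie eA Q S tau X).
Proof.
move=> tau0 tauT nX; rewrite /Lie.
have [nY _] := expGP bB (ltW tau0) nX.
have [V [nV rF eF _]] := expF_weak analytic gen T0 cst nQ tau0 tauT.
have beA := semigroup_bounded analytic (ltW tau0).
set Y := expG _ _ _ in nY *; apply/nonneg_opP; split.
  apply/selfadjoint_opP; split.
    have -> : expF eA Q tau Y = fun x => expcalA eA tau Y x + V x.
      by apply/funext => x; rewrite eF.
    apply: bounded_addop; last exact: nonneg_bounded.
    apply: (bounded_comp beA); apply: (bounded_comp (nonneg_bounded nY)).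
    exact: adjoint_bounded.
  move=> x y; rewrite rF [RHS]ripC rF (nonneg_sym _ _ nY) (nonneg_sym _ _ nV).
  by rewrite (ripC (eA tau x)) (ripC x).
move=> x; rewrite rF addr_ge0 //.
  by have /nonneg_opP[_] := nY; exact.
by have /nonneg_opP[_] := nV; exact.
Qed.

Lemma error_const_ge1 : 1 <= error_const p T sigma q a CA.
Proof.
have k0 := defect_const_ge0; have M0 : 0 <= M by apply: le_trans M1.
by rewrite /error_const lerDr !mulr_ge0 ?expR_ge0 ?exprn_ge0 // ltW.
Qed.

Lemma error_const_gt0 : 0 < error_const p T sigma q a CA.
Proof. exact: lt_le_trans error_const_ge1. Qed.

Lemma max_step_gt0 : 0 < max_step p T sigma q a CA.
Proof.
rewrite /max_step invr_gt0; apply: ltr_wpDr error_const_gt0.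
by rewrite mulr_ge0 // mulr_ge0 // addr_ge0.
Qed.

(** The error is propagated with the powers [e^{k tau A}] attached to it: the powers of
    the semigroup bound then do not compound from step to step.  The
    iterates stay below [p + 1] because the error bound itself, proved up to step [n], is at
    most [1]. *)
Lemma lie_convergence (N : nat) : (0 < N)%N ->
  let tau := T / N%:R in
  tau <= max_step p T sigma q a CA ->
  forall n : nat, (n <= N)%N ->
    opnorm (P (n%:R * tau) \- iter n (Lie eA Q S tau) P0)
      <= error_const p T sigma q a CA * tau.
Proof.
move=> N0 tau htau.
have NR : 0 < N%:R :> R by rewrite ltr0n.
have tau0 : 0 < tau by rewrite divr_gt0.
have NtT : N%:R * tau = T by rewrite /tau mulrC divfK // gt_eqF.
clearbody tau.
have k0 := defect_const_ge0; set K := defect_const p sigma q a in k0.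
have M0 : 0 <= M by apply: le_trans M1.
set d := error_const p T sigma q a CA.
have d1 : 1 <= d by exact: error_const_ge1.
have s6 : 0 <= (p + 1) * sigma by rewrite mulr_ge0 // addr_ge0.
have htau' : tau * (d + 2 * (p + 1) * sigma) <= 1.
  by move: htau; rewrite /max_step -/d -div1r ler_pdivlMr //; lra.
have dtau : d * tau <= 1 by have := mulr_ge0 (ltW tau0) s6; lra.
have ptau : tau * ((p + 1) * sigma) <= 2^-1.
  by have := mulr_ge0 (ltW tau0) (le_trans ler01 d1); lra.
have ptau' : tau * (p * sigma) <= 2^-1.
  by apply: le_trans ptau; rewrite ler_wpM2l ?(ltW tau0) // ler_wpM2r // lerDl.
have kT k : (k <= N)%N -> 0 <= k%:R * tau <= T.
  move=> kN; rewrite mulr_ge0 ?(ltW tau0) //= -NtT ler_wpM2r ?(ltW tau0) //.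
  by rewrite ler_nat.
pose b := M ^+ 4 * K * tau ^+ 2; pose c := M ^+ 2 * (6 * (p + 1) * sigma) * tau.
have b0 : 0 <= b by rewrite !mulr_ge0 ?exprn_ge0 // ltW.
have c0 : 0 <= c.
  by rewrite /c -mulrA mulr_ge0 ?exprn_ge0 // mulr_ge0 ?(ltW tau0) // -mulrA mulr_ge0.
(* the bound of the n-th error, with b from the local error and c from stability *)
pose fix g (n : nat) : R := if n is m.+1 then g m * (1 + c) + b else 0.
have g0 n : 0 <= g n.
  by elim: n => //= n IH; rewrite addr_ge0 // mulr_ge0 // addr_ge0.
have gd n : (n <= N)%N -> g n <= d * tau.
  move=> nN; apply: le_trans (discrete_gronwall n b0 c0 (erefl : g 0%N = 0) _) _ => //.
  have /andP[h0 h1] := kT n nN.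
  have e1 : b * n%:R <= M ^+ 4 * K * T * tau.
    have := ler_wpM2l (_ : 0 <= M ^+ 4 * K * tau) h1.
    have h2 : 0 <= M ^+ 4 * K * tau by rewrite !mulr_ge0 ?exprn_ge0 // ltW.
    by move=> /(_ h2); rewrite /b; lra.
  have e2 : expR (c * n%:R) <= expR (M ^+ 2 * (6 * (p + 1) * sigma) * T).
    rewrite ler_expR /c -mulrA (mulrC tau); apply: ler_wpM2l => //.
    by rewrite mulr_ge0 ?exprn_ge0 // -mulrA mulr_ge0.
  apply: le_trans (_ : (M ^+ 4 * K * T * tau) * expR (M ^+ 2 * (6 * (p + 1) * sigma) * T) <= _).
    by apply: ler_pM; rewrite ?expR_ge0 // mulr_ge0.
  rewrite /d /error_const -/K -/M; lra.
pose L n := iter n (Lie eA Q S tau) P0.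
have key n : (n <= N)%N -> nonneg_op (L n) /\
   forall k x y, (n + k <= N)%N ->
     `|rip (P (n%:R * tau) (eA (k%:R * tau) x) - L n (eA (k%:R * tau) x))
           (eA (k%:R * tau) y)| <= g n * nrm x * nrm y.
  elim: n => [|n IH] nN.
    split=> // k x y _; rewrite /L mul0r.
    have -> : P 0 = P0 by case: sol.
    by rewrite subrr rip0l normr0 !mul0r.
  have {IH}[nL hL] := IH (ltnW nN).
  have nT := kT n (ltnW nN); have /andP[nT0 _] := nT.
  have nT1 : n%:R * tau + tau <= T.
    by have /andP[_] := kT _ nN; rewrite -natr1 mulrDl mul1r.
  have tauT : tau <= T by lra.
  have n1E : n.+1%:R * tau = n%:R * tau + tau by rewrite -natr1 mulrDl mul1r.
  have nX : nonneg_op (P (n%:R * tau)).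
    by apply: (solution_nonneg nP0 sol); rewrite nT0 /=; lra.
  have bX := nonneg_bounded nX; have bL := nonneg_bounded nL.
  set X := P (n%:R * tau) in nX bX hL *.
  have hX : bounded_by X p by exact: (solution_norm T0 sol nT).
  have hD x y : `|rip (X x - L n x) y| <= g n * nrm x * nrm y.
    by have := hL 0%N x y; rewrite addn0 mul0r !(semigroup0 analytic); apply; exact: ltnW.
  have gn1 : g n <= 1 by apply: le_trans dtau; exact: gd (ltnW nN).
  have hX1 : bounded_by X (p + 1).
    by move=> x; apply: le_trans (hX x) _; rewrite ler_wpM2r ?nrm_ge0 // lerDl.
  (* the iterate is within g n <= 1 of the exact solution *)
  have hL1 : bounded_by (L n) (p + 1).
    move=> x; rewrite -[L n x](subKr (X x)).
    apply: le_trans (nrmD _ _) _; rewrite nrmN mulrDl lerD //.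
    apply: nrm_le_rip => [|y]; first by rewrite mul1r nrm_ge0.
    apply: le_trans (ler_norm _) _; apply: le_trans (hD _ _) _.
    by rewrite ler_wpM2r ?nrm_ge0 // ler_wpM2r ?nrm_ge0.
  have [Yx nYx rYx] := riccati_resolvent_exists bB (ltW tau0) nX.
  have [nYz rYz] := expGP bB (ltW tau0) nL.
  have hS := opnormP bS.
  have p10 : 0 <= p + 1 by rewrite addr_ge0.
  have hYx := riccati_resolvent_bound (ltW tau0) p10 sigma_ge0 hS hX1 ptau rYx.
  have hYz := riccati_resolvent_bound (ltW tau0) p10 sigma_ge0 hS hL1 ptau rYz.
  have [V [nV rF _ hV]] := expF_weak analytic gen T0 cst nQ tau0 tauT.
  have LS : L n.+1 = expF eA Q tau (expG S tau (L n)) by [].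
  split; first by rewrite /L iterS; exact: lie_nonneg.
  move=> k x y nkN; set u := eA (k%:R * tau) x; set v := eA (k%:R * tau) y.
  have /andP[kT0 kTT] : 0 <= k%:R * tau <= T.
    by apply: kT; apply: leq_trans nkN; rewrite leq_addl.
  have nu z : nrm (eA (k%:R * tau) z) <= M * nrm z.
    by apply: (semigroup_norm analytic T0 cst); rewrite kT0.
  have step z : eA tau (eA (k%:R * tau) z) = eA (k.+1%:R * tau) z.
    by rewrite -(semigroupD analytic _ (ltW tau0) kT0) -natr1 mulrDl mul1r addrC.
  have nu1 z : nrm (eA (k.+1%:R * tau) z) <= M * nrm z.
    apply: (semigroup_norm analytic T0 cst); apply: kT.
    by apply: leq_trans nkN; rewrite addSnnS leq_addl.
  have loc := lie_local_error nT0 tau0 nT1 ptau' nYx rYx (hV u v).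
  have stab := riccati_resolvent_stability (eA tau u) (eA tau v) (ltW tau0) p10 (g0 n) bS sS
    bX bL nYx rYx rYz hS sigma_ge0 hYx hYz ptau hD.
  have prev := hL k.+1 x y; rewrite addnS -addSn in prev.
  have {}prev := prev nkN; rewrite -!step -/u -/v in prev.
  rewrite LS ripBl rF n1E.
  (* local error + change of the difference by the quadratic flow + old difference *)
  have -> : rip (P (n%:R * tau + tau) u) v
     - (rip (expG S tau (L n) (eA tau u)) (eA tau v) + rip (V u) v)
   = (rip (P (n%:R * tau + tau) u) v - rip (Yx (eA tau u)) (eA tau v) - rip (V u) v)
   + (rip (Yx (eA tau u) - expG S tau (L n) (eA tau u)) (eA tau v)
       - rip (X (eA tau u) - L n (eA tau u)) (eA tau v))
   + rip (X (eA tau u) - L n (eA tau u)) (eA tau v).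
    rewrite !ripBl; ring.
  apply: le_trans (ler_normD _ _) _.
  apply: le_trans (lerD (ler_normD _ _) (lexx _)) _.
  have x0 := nrm_ge0 x; have y0 := nrm_ge0 y.
  have l1 : K * tau ^+ 2 * (M * nrm u) * (M * nrm v)
     <= b * nrm x * nrm y.
    have -> : b * nrm x * nrm y
      = K * tau ^+ 2 * (M * (M * nrm x)) * (M * (M * nrm y)) by rewrite /b; ring.
    have Kt : 0 <= K * tau ^+ 2 by rewrite mulr_ge0 // exprn_ge0 // ltW.
    have Mu : M * nrm u <= M * (M * nrm x) by apply: ler_wpM2l => //; exact: nu.
    have Mv : M * nrm v <= M * (M * nrm y) by apply: ler_wpM2l => //; exact: nu.
    apply: ler_pM => //; last exact: ler_wpM2l.
      by apply: mulr_ge0 => //; apply: mulr_ge0 => //; exact: nrm_ge0.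
    by apply: mulr_ge0 => //; exact: nrm_ge0.
  have l2 : tau * (6 * (p + 1) * sigma) * g n * nrm (eA tau u) * nrm (eA tau v)
     <= c * g n * nrm x * nrm y.
    have -> : c * g n * nrm x * nrm y
      = tau * (6 * (p + 1) * sigma) * g n * (M * nrm x) * (M * nrm y) by rewrite /c; ring.
    have Ct : 0 <= tau * (6 * (p + 1) * sigma) * g n.
      by rewrite mulr_ge0 // mulr_ge0 ?(ltW tau0) // -mulrA mulr_ge0.
    have nu2 z : nrm (eA tau (eA (k%:R * tau) z)) <= M * nrm z by rewrite step.
    apply: ler_pM; [|exact: nrm_ge0| |exact: nu2].
      by apply: mulr_ge0 => //; exact: nrm_ge0.
    by apply: ler_wpM2l => //; exact: nu2.
  have f := lerD (lerD (le_trans loc l1) (le_trans stab l2)) prev.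
  apply: le_trans f _; rewrite [g n.+1]/= le_eqVlt; apply/orP; left; apply/eqP; ring.
move=> n nN; have [nL hL] := key n nN.
apply: opnorm_le; first by rewrite mulr_ge0 ?(ltW tau0) // (le_trans ler01).
move=> x; apply: nrm_le_rip => [|y].
  by rewrite mulr_ge0 ?nrm_ge0 // mulr_ge0 ?(ltW tau0) // (le_trans ler01).
have := hL 0%N x y; rewrite addn0 mul0r !(semigroup0 analytic) => /(_ nN) h.
apply: le_trans (ler_norm _) _; apply: le_trans h _.
by rewrite !ler_wpM2r ?nrm_ge0 // gd.
Qed.
End Convergence.

Theorem theorem3p8 (R : realType) :
  (* D and taustar see ||P||_oo, T, ||S||, ||Q||, ||AS|| and C_A only. *)
  exists D taustar : R -> R -> R -> R -> R -> R -> R,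
  forall (H U Y : hilbertType R) (T : R) (A : unbounded_op H)
    (eA : R -> H -> H) (CA : R) (B : U -> H) (E : H -> Y)
    (P0 : H -> H) (P : R -> H -> H),
  let Q := adjoint E \o E in
  let S := B \o adjoint B in
  0 < T ->
  bounded_op B -> bounded_op E -> nonneg_op P0 ->
  analytic_semigroup eA -> is_generator A eA ->
  semigroup_constant T A eA CA ->
  bounded_op S ->
  (forall x, dom A (S x)) -> bounded_op (A \o S) ->
  Riccati_solution T A Q S P0 P ->
  let d := D (sup_norm T P) T (opnorm S) (opnorm Q) (opnorm (A \o S)) CA in
  let ts :=
    taustar (sup_norm T P) T (opnorm S) (opnorm Q) (opnorm (A \o S)) CA in
  [/\ 0 < d, 0 < ts &
    forall N : nat, (0 < N)%N ->
      let tau := T / N%:R in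
      tau <= ts ->
      forall n : nat, (n <= N)%N ->
        opnorm (P (n%:R * tau) \- iter n (Lie eA Q S tau) P0) <= d * tau].
Proof.
exists (@error_const R), (@max_step R).
move=> H U Y T A eA CA B E P0 P Q S T0 bB bE nP0 an gen cst bS domS bAS sol d ts.
have nQ : nonneg_op Q := adjoint_comp_nonneg bE.
have d0 : 0 < d by exact: (error_const_gt0 an T0 cst nQ bB bAS sol).
have ts0 : 0 < ts by exact: (max_step_gt0 an T0 cst nQ bB bAS sol).
by split=> // N N0; exact: (lie_convergence an gen T0 cst nQ bB domS bAS nP0 sol N0).
Qed.
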